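(* Let $m\ge1$, $\Gamma\le S_m$ arbitrary. Take $\pi$ uniform in $\Gamma^n\rtimes S_n$, let $C_1,C_2,\dots$ be its cycle lengths and $C=\left(\frac{C_1}{mn},\frac{C_2}{mn},\dots\right)$. Then $$d_{L^\infty}(C,\mathcal A)\le \frac1n,\qquad d_{L^1}(C,\mathcal A)\le\frac{3(\log n+\gamma)}{n}+O(1/n^2),$$ where $\mathcal A$ is the random partition defined in the context (the solution of $\mathcal A\overset d=(U\mathcal B,(1-U)\mathcal A)$).
   Context: Partitions of unity are nonnegative sequences summing to $1$, identified with their nonincreasing rearrangements (padded with zeros); $d_\rho(X,Y)=\inf\mathbb E\rho(X,Y)$ over couplings, with $\rho$ the $\ell^\infty$ or $\ell^1$ distance of sorted sequences. $\Gamma^n\rtimes S_n$ consists of permutations $(g_1,\dots,g_n;h)$, $g_i\in\Gamma$, $h\in S_n$, of $\{1,\dots,mn\}$ acting by $(i-1)m+r\mapsto(h(i)-1)m+g_i(r)$. $\mathcal B=\left(\frac{D_1}{m},\frac{D_2}{m},\dots\right)$ where $D_1,D_2,\dots$ are the cycle lengths of a uniform element of $\Gamma$. Let $U_1,U_2,\dots$ be iid uniform on $[0,1]$, $V_i=U_i\prod_{r<i}(1-U_r)$, and $\mathcal B^{(1)},\mathcal B^{(2)},\dots$ iid copies of $\mathcal B$ independent of the $U$'s; $\mathcal A$ is the partition with parts $V_i\,\mathcal B^{(i)}_j$, $i,j\ge1$. It satisfies $\mathcal A\overset d=(U\mathcal B,(1-U)\mathcal A)$ with $U$ uniform and $U,\mathcal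 B,\mathcal A$ independent on the right. $\gamma$ is the Euler–Mascheroni constant. *)

(* Defs.v *)
From HB Require Import structures.
From mathcomp Require Import all_boot all_order all_algebra all_fingroup.
From mathcomp Require Import all_classical all_reals all_analysis.
From mathcomp Require Import measurable_realfun.
Set Implicit Arguments. Unset Strict Implicit. Unset Printing Implicit Defensive.
Import Order.TTheory GRing.Theory Num.Theory.
Import numFieldNormedType.Exports.
Local Open Scope classical_set_scope.
Local Open Scope ring_scope.

Section Defs.
Variable R : realType.

(* The wreath product Gamma^n ⋊ S_n, as permutations of 'I_n * 'I_m, where the
   pair (i, r) stands for the point (i-1)m + r of {1,...,mn}:
   (g_1,...,g_n;h) acts by (i,r) |-> (h i, g_i r). *)
Definition wreath (m n : nat) (Gam : {group {perm 'I_m}}) : {set {perm ('I_n * 'I_m)}} :=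
  [set p : {perm ('I_n * 'I_m)} | [exists h : 'S_n, exists g : {ffun 'I_n -> {perm 'I_m}},
       [forall i, g i \in Gam] && [forall x : 'I_n * 'I_m, p x == (h x.1, g x.1 x.2)]]].

Definition cycle_lengths (T : finType) (p : {perm T}) : seq nat :=
  map (fun c : {set T} => #|c|%N) (enum (porbits p)).

Definition scaled_parts (s : seq nat) (N : nat) : nat -> R :=
  fun k => (nth 0%N s k)%:R / N%:R.

(* Nonincreasing rearrangement (padded with zeros) of a nonnegative family x
   indexed by I: the k-th largest entry (k = 0, 1, ...) counted with
   multiplicity, i.e. the sup of the t > 0 such that at least k+1 entries are
   >= t (and 0 if there is no such t). *)
Definition rearr (I : Type) (x : I -> R) (k : nat) : R :=
  sup [set t : R | t = 0 \/ (0 < t /\ exists f : 'I_k.+1 -> I,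
         injective f /\ forall j, t <= x (f j))].

Definition rho_Linf (a b : nat -> R) : \bar R :=
  ereal_sup (range (fun k => (`|a k - b k|)%:E)).
Definition rho_L1 (a b : nat -> R) : \bar R :=
  (\sum_(0 <= k <oo) (`|a k - b k|)%:E)%E.

Definition partC (m n : nat) (p : {perm ('I_n * 'I_m)}) : nat -> R :=
  scaled_parts (cycle_lengths p) (m * n).

Definition partB (m : nat) (s : {perm 'I_m}) : nat -> R :=
  scaled_parts (cycle_lengths s) m.

Definition stick (U : nat -> R) (i : nat) : R :=
  U i * \prod_(r < i) (1 - U r).

Definition partA (m : nat) (U : nat -> R) (S : nat -> {perm 'I_m}) : nat * nat -> R :=
  fun ij => stick U ij.1 * partB (S ij.1) ij.2.

Definition uniform_on (d : measure_display) (T : measurableType d)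
  (P : probability T R) (X : finType) (Pi : T -> X) (W : {set X}) : Prop :=
  (forall g, measurable [set w | Pi w = g]) /\
  forall g, g \in W -> P [set w | Pi w = g] = (#|W|%:R^-1)%:E.

(* U_0, U_1, ... iid uniform on [0,1], sigma_0, sigma_1, ... iid uniform on
   Gamma, all mutually independent: characterised by the joint law of the
   first N of them, for every N. *)
Definition stick_ingredients (d : measure_display) (T : measurableType d)
  (P : probability T R) (m : nat) (Gam : {group {perm 'I_m}})
  (U : nat -> T -> R) (S : nat -> T -> {perm 'I_m}) : Prop :=
  (forall i, measurable_fun setT (U i)) /\
  (forall i g, measurable [set w | S i w = g]) /\
  forall (N : nat) (t : nat -> R) (g : nat -> {perm 'I_m}),
    (forall i, (i < N)%N -> 0 <= t i <= 1 /\ g i \in Gam) ->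
    P [set w | forall i, (i < N)%N -> U i w <= t i /\ S i w = g i]
      = (\prod_(i < N) (t i / #|Gam|%:R))%:E.

(* d_rho(C, A) = inf over couplings of E rho(C, A). A coupling is a
   probability space carrying a uniform element Pi of Gamma^n ⋊ S_n (so that
   C = partC Pi) together with the ingredients (U_i), (sigma_i) of A. *)
Definition dist_CA (rho : (nat -> R) -> (nat -> R) -> \bar R)
  (m n : nat) (Gam : {group {perm 'I_m}}) : \bar R :=
  ereal_inf [set e : \bar R | exists (d : measure_display) (T : measurableType d)
     (P : probability T R) (Pi : T -> {perm ('I_n * 'I_m)})
     (U : nat -> T -> R) (S : nat -> T -> {perm 'I_m}),
     [/\ uniform_on P Pi (wreath n Gam),
         stick_ingredients P Gam U S,
         measurable_fun [set: T]
           (fun w : T => (rho (rearr (partC (Pi w))) (rearr (partA (fun i => U i w) (fun i => S i w))) : \bar R)) &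
         e = (\int[P]_w rho (rearr (partC (Pi w)))
                            (rearr (partA (fun i => U i w) (fun i => S i w))))%E]].

Definition euler_gamma : R :=
  limn (fun n : nat => \sum_(1 <= k < n.+1) (k%:R)^-1 - ln n%:R).

End Defs.

(* Main.v *)
Require Import Defs.
From HB Require Import structures.
From mathcomp Require Import all_boot all_order all_algebra all_fingroup.
From mathcomp Require Import all_classical all_reals all_analysis.
From mathcomp Require Import measurable_realfun.
From mathcomp Require Import zify ring lra.
Set Implicit Arguments. Unset Strict Implicit. Unset Printing Implicit Defensive.
Import Order.TTheory GRing.Theory Num.Theory.
Local Open Scope ring_scope.

(** Break the sticks from the right of [[0, n]]: the [i]-th stick is [(y', y]] with
    [y' = y (1 - U_i)], and it carries the permutation [sigma_i] of [Gam]. Given that it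
    contains one of the lattice points [1, ..., n], the number of remaining points
    below it is uniform, so that the numbers of points in the nonempty sticks have the
    law of the cycle lengths of a uniform element of [S_n] (Feller coupling), and those
    sticks together with their [sigma_i] determine the cycle type of a uniform element of
    the wreath product. A uniform permutation of that type is therefore uniform in the
    wreath product. A stick of length [l] contains [L] points with [|L - l| < 1], and the
    parts of [sigma_i] sum to [1], which matches the parts of the two partitions with
    errors at most [1 / n]; rearranging is [1]-Lipschitz for the sup norm. For the [l^1]
    norm both partitions have total mass at most [1], so that the distance is at most
    twice the mass of [C] not covered by [A], i.e. at most [2 / n] per nonempty stick, and
    the expected number of nonempty sticks is the harmonic number [H_n <= 1 + ln n]. All
    the random variables are functions of a single uniform number, through its binary
    digits. *)

(** * Uniform elements of the wreath product and the Feller coupling *)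

(** The sticks end at real positions, whereas the Feller coupling counts points. They agree exactly
    because the law of the remaining run depends on the position [y] only through its integer part
    [k]: conditioned to fall below [k], the next position is uniform on [[0, k)], so its integer
    part is uniform on [0, ..., k - 1]. On the side of the permutations the same recursion comes
    from revealing the image of one fibre at a time. A revealed fibre is either split off with its
    cycles or absorbed into the next one, whose points then count with a larger weight; hence the
    weighted cycle lengths and the disregard of zero weights.

    Laws are identified through one-sided estimates: lower bounds for disjoint events that add up to
    1 are equalities. This absorbs the null set on which the sticks never pass below 1, where the
    coupling takes arbitrary values.

    Several block sequences give the same cycle lengths, so the permutation is drawn from the class
    of these lengths, with a number independent of the sticks; uniformity results because the mass
    of a class is its relative size in the wreath product. *)

Section PermEq.
Variables T1 T2 : finType.

(** Only elements of [Y] of weight zero may escape [kap]: in the applications these are the fixed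
    points left over a removed fibre. *)
Lemma perm_eq_pos_imset (X : {set T1}) (Y : {set T2}) (f1 : T1 -> nat)
    (f2 : T2 -> nat) (kap : T1 -> T2) :
  {in X &, injective kap} -> (forall c, c \in X -> kap c \in Y) ->
  (forall c, c \in X -> f2 (kap c) = f1 c) ->
  (forall d, d \in Y -> (0 < f2 d)%N -> d \in kap @: X) ->
  perm_eq [seq v <- [seq f1 c | c <- enum X] | (0 < v)%N]
          [seq v <- [seq f2 d | d <- enum Y] | (0 < v)%N].
Proof.
move=> kI kXY kf kY; rewrite !filter_map.
set s1 := seq.filter _ (enum X); set s2 := seq.filter _ (enum Y).
have -> : [seq f1 c | c <- s1] = [seq f2 d | d <- [seq kap c | c <- s1]].
  rewrite -map_comp; apply/eq_in_map => c; rewrite mem_filter mem_enum.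
  by case/andP => _ cX /=; rewrite kf.
apply: perm_map; apply: uniq_perm.
- rewrite map_inj_in_uniq 1?filter_uniq ?enum_uniq// => c c'.
  by rewrite [c \in _]mem_filter [c' \in _]mem_filter !mem_enum => /andP[_ +] /andP[_ +]; apply: kI.
- by rewrite filter_uniq// enum_uniq.
move=> d; rewrite mem_filter mem_enum /=; apply/mapP/andP => [[c]|[f2d dY]].
  rewrite mem_filter mem_enum /= => /andP[fc cX] ->.
  by rewrite kf// fc kXY.
have /imsetP[c cX dE] := kY d dY f2d.
by exists c => //; rewrite mem_filter mem_enum /= -kf// -dE f2d.
Qed.

End PermEq.

Section PorbitInduced.
Variables (T : finType) (p q : {perm T}) (F : {set T}).
Hypothesis pF : forall x, x \in F -> p x \notin F.
Hypothesis qE : forall x, x \notin F -> q x = if p x \in F then p (p x) else p x.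

(** [q] is the map induced by [p] off [F], a set that [p] never visits twice in a row. One step of
    [q] uses one or two steps of [p], whence the strong induction on the exponent. *)
Lemma porbit_induced x : x \notin F -> porbit q x = porbit p x :\: F.
Proof.
move=> xF; have qnF y : y \notin F -> q y \notin F.
  by move=> yF; rewrite qE//; case: ifP => [/pF|->].
apply/setP => y; rewrite !inE; apply/porbitP/andP => [[i ->]|[yF /porbitP[i yE]]].
  elim: i => [|i [IH1 IH2]]; first by rewrite expg0 perm1 xF porbit_id.
  rewrite expgSr permM qnF//; split=> //; rewrite qE//.
  case/porbitP: IH2 => j ->.
  rewrite -!permM -expgSr; case: ifP => _; first by rewrite -expgSr mem_porbit.
  by rewrite mem_porbit.
elim/ltn_ind: i x xF y yF yE => i IH x xF y yF yE.
case: i => [|i] in IH yE; first by exists 0; rewrite yE.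
have [pxF|pxF] := boolP (p x \in F).
  case: i => [|i] in IH yE; first by rewrite yE expg1 pxF in yF.
  have [|j yj] := IH i (leqnSn _) (p (p x)) (pF pxF) y yF.
    by rewrite yE !expgS !permM.
  by rewrite yj; exists j.+1; rewrite expgS permM qE// pxF.
have [|j yj] := IH i (ltnSn _) (p x) pxF y yF.
  by rewrite yE !expgS !permM.
by rewrite yj; exists j.+1; rewrite expgS permM qE// (negbTE pxF).
Qed.

End PorbitInduced.

(** * Removing the fibres of the wreath product one at a time *)

Section Wreath.
Variables (m n : nat) (Gam : {group {perm 'I_m}}).
Notation pt := ('I_n * 'I_m)%type.
Implicit Types (p q : {perm pt}) (A : {set 'I_n}) (om : 'I_n -> nat).

Lemma wreathP p : reflect (exists (h : 'S_n) (g : 'I_n -> {perm 'I_m}),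
   (forall i, g i \in Gam) /\ (forall x, p x = (h x.1, g x.1 x.2)))
  (p \in wreath n Gam).
Proof.
rewrite inE; apply: (iffP existsP) => -[h].
  case/existsP => g /andP[/forallP gG /forallP pE].
  by exists h, g; split=> // x; apply/eqP.
case=> g [gG pE]; exists h; apply/existsP; exists [ffun i => g i].
by apply/andP; split; apply/forallP => i; rewrite ffunE// pE.
Qed.

Lemma wr_inj (h : 'S_n) (g : 'I_n -> {perm 'I_m}) :
  injective (fun x : pt => (h x.1, g x.1 x.2)).
Proof. by move=> [i r] [j s] /= [/perm_inj -> /perm_inj ->]. Qed.

Definition wr (h : 'S_n) (g : 'I_n -> {perm 'I_m}) : {perm pt} := perm (@wr_inj h g).

Lemma wrE h g x : wr h g x = (h x.1, g x.1 x.2). Proof. by rewrite permE. Qed.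

Lemma wreath_group : group_set (wreath n Gam).
Proof.
apply/group_setP; split.
  by apply/wreathP; exists 1%g, (fun=> 1%g); split=> // x; rewrite !perm1; case: x.
move=> p q /wreathP[h [g [gG pE]]] /wreathP[h' [g' [gG' qE]]].
apply/wreathP; exists (h * h')%g, (fun i => g i * g' (h i))%g; split=> [i|x].
  by rewrite groupM.
by rewrite !permM pE qE.
Qed.

Canonical wreath_gp := Group wreath_group.

(* Exchanges the fibres over [a] and [b], the first being mapped to the second by
   [gam]; for [a = b] it is [gam] on the fibre over [a]. *)
Definition wswap (a b : 'I_n) (gam : {perm 'I_m}) : {perm pt} :=
  wr (tperm a b) (fun i => if i == a then gam else if i == b then gam^-1 else 1)%g.

Lemma wswapE a b gam x : wswap a b gam x =
  if x.1 == a then (b, gam x.2) else if x.1 == b then (a, gam^-1%g x.2) else x.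
Proof.
rewrite wrE; case: x => i r /=; case: ifP => [/eqP->|/negbT ia]; first by rewrite tpermL.
case: ifP => [/eqP->|/negbT ib]; first by rewrite tpermR.
by rewrite tpermD 1?eq_sym// perm1.
Qed.

Lemma wswap_wreath a b gam : gam \in Gam -> wswap a b gam \in wreath n Gam.
Proof.
move=> gG; apply/wreathP; exists (tperm a b).
exists (fun i => if i == a then gam else if i == b then gam^-1 else 1)%g.
split=> [|x]; last by rewrite /wswap wrE.
by move=> i; case: ifP => // _; case: ifP => // _; rewrite groupV.
Qed.

Definition wreath_on A := [set p in wreath n Gam | [forall x, (x.1 \notin A) ==> (p x == x)]].

Lemma wreath_onP A p : reflect
  (p \in wreath n Gam /\ forall x, x.1 \notin A -> p x = x) (p \in wreath_on A).
Proof.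
apply: (iffP idP); first rewrite finset.in_set.
  by case/andP => pW /forallP H; split=> // x xA; apply/eqP; move: (H x); rewrite xA.
by case=> pW H; rewrite finset.in_set pW; apply/forallP => x; apply/implyP => /H ->.
Qed.

Lemma wreath_onT : wreath_on [set: 'I_n] = wreath n Gam.
Proof.
by apply/setP => p; apply/wreath_onP/idP => [[]//|pW]; split=> // x; rewrite inE.
Qed.

Hypothesis m_gt0 : (0 < m)%N.

(** Fisher-Yates step: in a product the left factor acts first and [q] fixes the fibre over [a], so
    [b] and [gam] are read off from the image of that fibre, which is nonempty. Dividing by the swap
    then recovers [q]. *)
Lemma sum_wreath_on (V : nmodType) A a (F : {perm pt} -> V) : a \in A ->
  \sum_(p in wreath_on A) F p =
  \sum_(b in A) \sum_(gam in Gam) \sum_(q in wreath_on (A :\ a)) F (q * wswap a b gam)%g.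
Proof.
move=> aA; pose D := finset.setX (finset.setX A Gam) (wreath_on (A :\ a)).
pose kap (u : 'I_n * {perm 'I_m} * {perm pt}) := (u.2 * wswap a u.1.1 u.1.2)%g.
have qa q r : q \in wreath_on (A :\ a) -> q (a, r) = (a, r).
  by case/wreath_onP => _; apply; rewrite !inE eqxx.
have kD : {in D &, injective kap}.
  move=> [[b g] q] [[b' g'] q']; rewrite !finset.in_setX /= => /andP[/andP[bA gG] qW].
  move=> /andP[/andP[bA' gG'] qW'] /permP kE.
  have bg r : (b, g r) = (b', g' r).
    by have := kE (a, r); rewrite /kap /= !permM (qa _ _ qW) (qa _ _ qW') !wswapE eqxx.
  have bE : b = b' by case: (bg (Ordinal m_gt0)).
  have gE : g = g' by apply/permP => r; case: (bg r).
  congr (_, _, _) => //; apply/permP => x; have := kE x.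
  by rewrite /kap /= !permM /= bE gE => /perm_inj.
have -> : wreath_on A = kap @: D.
  apply/setP => p; apply/idP/imsetP => [/wreath_onP[pW pA]|[[[b g] q]]].
    have /wreathP[h [g [gG pE]]] := pW.
    have hA : h a \in A.
      apply: contraT => hA; have := pA (h a, Ordinal m_gt0) hA; rewrite pE /=.
      by case=> /perm_inj ha _; rewrite ha aA in hA.
    exists (h a, g a, p * (wswap a (h a) (g a))^-1)%g; last by rewrite /kap /= mulgKV.
    rewrite inE finset.in_setX /= hA gG /=; apply/wreath_onP; split.
      by rewrite groupM ?groupV//; apply: wswap_wreath.
    move=> x; rewrite !inE negb_and negbK => H; rewrite permM.
    apply: (can_inj (permK (wswap a (h a) (g a)))); rewrite permKV.
    case/orP: H => [/eqP xa|xA]; first by rewrite pE wswapE xa eqxx.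
    rewrite pA// wswapE; case: eqP => [xa|_]; first by rewrite xa aA in xA.
    by case: eqP => [xa|_//]; rewrite xa hA in xA.
  rewrite inE finset.in_setX /= => /andP[/andP[bA gG]] /wreath_onP[qW qA] ->.
  apply/wreath_onP; split; first by rewrite /kap groupM//; apply: wswap_wreath.
  move=> x xA; rewrite /kap permM qA ?inE ?negb_and ?xA ?orbT//= wswapE.
  case: eqP => [xa|_]; first by rewrite xa aA in xA.
  by case: eqP => [xa|_//]; rewrite xa bA in xA.
rewrite (big_imset _ kD) /= pair_big /= pair_big /=.
by apply: eq_big => -[[b g] q] //=; rewrite !inE.
Qed.

(** The weight [om i] is the number of original fibres that the fibre over [i] stands for: 0 once it
    is removed, the length of the current block for the current fibre, 1 for an untouched fibre. *)
Definition wcl om p : seq nat :=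
  [seq (\sum_(x in c) om x.1)%N | c : {set pt} <- enum (porbits p)].

Let fib a : {set pt} := [set x : pt | x.1 == a].

(** The swap inserts the fibre over [a] into the cycles of [q] just before the fibre over [b]. So
    [q] is induced by [p] off the fibre over [a], and a cycle of [p] has as many points over [a] as
    over [b]: moving the weight of [a] onto [b] preserves its total. *)
Lemma wcl_merge om A a b gam q : a \in A -> b != a -> q \in wreath_on (A :\ a) ->
  perm_eq [seq v <- wcl om (q * wswap a b gam)%g | (0 < v)%N]
   [seq v <- wcl (fun i => if i == a then 0 else if i == b then om b + om a else om i)%N q
      | (0 < v)%N].
Proof.
move=> aA ba /wreath_onP[qW qA]; set p := (q * _)%g.
pose om' i := if i == a then 0%N else if i == b then (om b + om a)%N else om i; rewrite -[X in wcl X q]/om'.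
have qF x : x \in fib a -> q x = x by rewrite inE => /eqP xa; apply: qA; rewrite !inE xa eqxx.
have pa x : x \in fib a -> p x = (b, gam x.2).
  by move=> xF; rewrite permM qF// wswapE; move: xF; rewrite inE => ->.
have pF x : x \in fib a -> p x \notin fib a by move=> xF; rewrite pa// inE.
have qE x : x \notin fib a -> q x = if p x \in fib a then p (p x) else p x.
  move=> xF; have qxF : q x \notin fib a.
    apply: contra xF => qxF; suff -> : x = q x by [].
    by apply: (@perm_inj _ q); rewrite [in RHS]qF.
  have pxE : p x = if (q x).1 == b then (a, gam^-1%g (q x).2) else q x.
    by rewrite permM wswapE; move: qxF; rewrite inE => /negbTE ->.
  rewrite pxE; case: eqP => [qxb|_]; last by rewrite (negbTE qxF).
  by rewrite inE eqxx pa ?inE//= permKV -qxb -surjective_pairing.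
have pO := porbit_induced pF qE.
have nF x : exists2 y, y \notin fib a & porbit p x = porbit p y.
  have [xF|xF] := boolP (x \in fib a); last by exists x.
  exists (p x); first exact: pF.
  by apply/esym; have := porbit_perm p 1 x; rewrite expg1.
apply: (perm_eq_pos_imset (kap := fun c => c :\: fib a)).
- move=> c c' /imsetP[x _ ->] /imsetP[y _ ->].
  have [x' x'F ->] := nF x; have [y' y'F ->] := nF y => E.
  apply/eqP; rewrite eq_porbit_mem.
  have : x' \in porbit p x' :\: fib a by rewrite inE x'F porbit_id.
  by rewrite E inE => /andP[].
- by move=> c /imsetP[x _ ->]; have [y yF ->] := nF x; rewrite -pO//; apply: imset_f.
- move=> c /imsetP[x _ ->]; set c' := porbit p x.
  (* [p] maps the points of the cycle over [a] bijectively onto its points over [b]. *)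
  have cab : #|c' :&: fib a| = #|(c' :\: fib a) :&: fib b|.
    rewrite -(card_imset _ (@perm_inj _ p)).
    apply: eq_card => y; rewrite !inE.
    apply/imsetP/andP => [[z]|[/andP[ya yc] /eqP yb]]; last first.
      have zE : p (a, gam^-1%g y.2) = y.
        by rewrite pa ?inE//= permKV -yb -surjective_pairing.
      exists (a, gam^-1%g y.2); last by rewrite zE.
      rewrite !inE eqxx andbT -eq_porbit_mem.
      rewrite -eq_porbit_mem in yc.
      by have := porbit_perm p 1 (a, gam^-1%g y.2); rewrite expg1 zE (eqP yc) => ->.
    rewrite !inE => /andP[zc /eqP za] ->; rewrite pa ?inE ?za//= ba eqxx.
    rewrite -eq_porbit_mem in zc; split=> //=.
    rewrite -eq_porbit_mem -(eqP zc) -(pa z) ?inE ?za//.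
    by have := porbit_perm p 1 z; rewrite expg1 => ->.
  have E1 : (\sum_(y in c' :&: fib a) om y.1 = #|(c' :\: fib a) :&: fib b| * om a)%N.
    by rewrite -cab -sum_nat_const; apply: eq_bigr => y; rewrite !inE => /andP[_ /eqP ->].
  have E2 : (\sum_(y in (c' :\: fib a) :&: fib b) om y.1 = #|(c' :\: fib a) :&: fib b| * om b)%N.
    by rewrite -sum_nat_const; apply: eq_bigr => y; rewrite !inE => /andP[_ /eqP ->].
  have E3 : (\sum_(y in (c' :\: fib a) :&: fib b) om' y.1 =
      #|(c' :\: fib a) :&: fib b| * (om b + om a))%N.
    rewrite -sum_nat_const; apply: eq_bigr => y; rewrite !inE.
    by case/andP=> /andP[/negbTE ya _] /eqP yb; rewrite /om' ya yb eqxx.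
  have E4 : (\sum_(y in (c' :\: fib a) :\: fib b) om' y.1 =
      \sum_(y in (c' :\: fib a) :\: fib b) om y.1)%N.
    apply: eq_bigr => y; rewrite !inE => /andP[/negbTE yb /andP[/negbTE ya _]].
    by rewrite /om' ya yb.
  rewrite (big_setID (fib b)) /= [RHS](big_setID (fib a)) /=.
  rewrite [X in _ = (_ + X)%N](big_setID (fib b)) /=.
  by rewrite E1 E2 E3 E4 mulnDr addnCA addnA.
- move=> d /imsetP[x _ ->]; have [xF|xF] := boolP (x \in fib a); last first.
    by move=> _; rewrite pO//; apply/imsetP; exists (porbit p x) => //; apply: imset_f.
  rewrite big1// => y /porbitP[i ->]; have -> : (q ^+ i)%g x = x.
    by elim: i => [|i IH]; rewrite ?expg0 ?perm1// expgSr permM IH qF.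
  by move: xF; rewrite inE /om' => ->.
Qed.

(** Here [p] acts as [gam] on the fibre over [a] and as [q] elsewhere, so that its cycles either lie
    in that fibre or avoid it. *)
Lemma wcl_close om A a gam q : a \in A -> q \in wreath_on (A :\ a) ->
  perm_eq [seq v <- wcl om (q * wswap a a gam)%g | (0 < v)%N]
   [seq v <- [seq (om a * c)%N | c <- cycle_lengths gam] ++
      wcl (fun i => if i == a then 0 else om i)%N q | (0 < v)%N].
Proof.
move=> aA /wreath_onP[qW qA]; set p := (q * _)%g.
pose om' i := if i == a then 0%N else om i; rewrite -[X in wcl X q]/om'.
have qF x : x \in fib a -> q x = x by rewrite inE => /eqP xa; apply: qA; rewrite !inE xa eqxx.
have pa r : p (a, r) = (a, gam r) by rewrite permM qF ?inE// wswapE eqxx.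
have qnF x : x \notin fib a -> q x \notin fib a.
  apply: contra => qxF; suff -> : x = q x by [].
  by apply: (@perm_inj _ q); rewrite [in RHS]qF.
have pE x : x \notin fib a -> p x = q x.
  move=> xF; rewrite permM wswapE; case: eqP => // E.
  by have := qnF _ xF; rewrite inE E eqxx.
have pq i x : x \notin fib a -> (p ^+ i)%g x = (q ^+ i)%g x /\ (q ^+ i)%g x \notin fib a.
  move=> xF; elim: i => [|i [IH1 IH2]]; first by rewrite !expg0 perm1.
  by rewrite !expgSr permM IH1 pE// permM qnF.
have poq x : x \notin fib a -> porbit p x = porbit q x.
  by move=> xF; apply/setP => y; apply/porbitP/porbitP => -[i ->]; exists i; case: (pq i x xF).
have pai i r : (p ^+ i)%g (a, r) = (a, (gam ^+ i)%g r).
  by elim: i => [|i IH]; rewrite ?expg0 ?perm1// expgSr permM IH pa expgSr permM.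
have poa r : porbit p (a, r) = pair a @: porbit gam r.
  apply/setP => y; apply/porbitP/imsetP => [[i ->]|[s /porbitP[i ->] ->]].
    by exists ((gam ^+ i)%g r); rewrite ?mem_porbit.
  by exists i.
pose X1 := [set c in porbits p | c \subset fib a].
pose X2 := [set c in porbits p | ~~ (c \subset fib a)].
have X12 : perm_eq (enum (porbits p)) (enum X1 ++ enum X2).
  apply: uniq_perm; rewrite ?enum_uniq ?cat_uniq ?enum_uniq ?andbT/=//.
    by apply/hasPn => c; rewrite !mem_enum !inE => /andP[_ /negbTE ->]; rewrite andbF.
  by move=> c; rewrite mem_cat !mem_enum !inE -andb_orr orbN andbT.
have noF c : c \in X2 -> exists2 x, x \notin fib a & c = porbit p x.
  rewrite inE => /andP[/imsetP[x _ ->]] cF; exists x => //; apply: contra cF => xF.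
  apply/fintype.subsetP => y /porbitP[i ->]; case: x xF => i' r; rewrite inE /= => /eqP ->.
  by rewrite pai inE.
apply: (@perm_trans _ [seq v <- [seq (\sum_(x in c) om x.1)%N | c : {set pt} <- enum X1 ++ enum X2] | (0 < v)%N]).
  by apply: perm_filter; apply: perm_map.
rewrite map_cat !filter_cat; apply: perm_cat.
  rewrite perm_sym /cycle_lengths -map_comp.
  apply: (perm_eq_pos_imset (kap := fun c : {set 'I_m} => pair a @: c)).
  - by move=> c c' _ _ /imset_inj; apply=> r s [].
  - move=> c /imsetP[r _ ->]; rewrite !inE -poa imset_f//=.
    by rewrite poa; apply/fintype.subsetP => x /imsetP[s _ ->]; rewrite inE.
  - move=> c _; rewrite big_imset /=; last by move=> r s _ _ [].
    by rewrite sum_nat_const mulnC.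
  - move=> d; rewrite !inE => /andP[/imsetP[[i r] _ ->] dF] _.
    have := fintype.subsetP dF _ (porbit_id p (i, r)); rewrite inE /= => /eqP ->.
    by rewrite poa; apply: imset_f; apply: imset_f.
apply: (perm_eq_pos_imset (kap := id)) => //.
- by move=> c /noF[x xF ->]; rewrite poq// imset_f.
- move=> c /noF[x xF ->]; apply: eq_bigr => y; rewrite poq// => /porbitP[i ->].
  by have [_] := pq i x xF; rewrite inE /om' => /negbTE ->.
- move=> d /imsetP[x _ ->]; have [xF|xF] := boolP (x \in fib a); last first.
    rewrite imset_id inE -poq// imset_f//= => _.
    by apply/fintype.subsetPn; exists x; rewrite ?porbit_id.
  rewrite big1// => y /porbitP[i ->]; have -> : (q ^+ i)%g x = x.
    by elim: i => [|i IH]; rewrite ?expg0 ?perm1// expgSr permM IH qF.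
  by move: xF; rewrite inE /om' => ->.
Qed.

(** A cycle of length [L] of the base permutation, with cycle product [sigma], yields a cycle of
    length [L c] for each cycle of length [c] of [sigma]. *)
Definition blocks (t : seq (nat * {perm 'I_m})) : seq nat :=
  flatten [seq [seq (u.1 * c)%N | c <- cycle_lengths u.2] | u <- t].

Variable R : numFieldType.

(* The mean of [psi (beta_1, beta_2, ...)] over the blocks (length, element of [Gam])
   produced by the Feller coupling, when [k] points remain and the current block has
   length [l]: it is closed with probability [1 / k]. *)
Fixpoint feller_mean (k l : nat) (psi : seq (nat * {perm 'I_m}) -> R) : R :=
  if k is k'.+1 then
    (#|Gam|%:R^-1 * (\sum_(gam in Gam) feller_mean k' 1 (fun t => psi ((l, gam) :: t)))
     + k'%:R * feller_mean k' l.+1 psi) / k'.+1%:R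
  else psi [::].

Lemma eq_feller_mean k l psi psi' : psi =1 psi' -> feller_mean k l psi = feller_mean k l psi'.
Proof. by move=> /funext ->. Qed.

(** Induction on the number of fibres, [a] being the current one. The choice [b = a] closes the
    block; each of the other [k - 1] choices makes [b] current with weight [l + 1]. The factor in
    front is the number of elements of [wreath_on A]. *)
Lemma sum_wreath_feller k A a l om (phi : seq nat -> R) : #|A| = k ->
  (forall s s', perm_eq [seq v <- s | (0 < v)%N] [seq v <- s' | (0 < v)%N] -> phi s = phi s') ->
  (forall i, i \notin A -> om i = 0%N) -> (forall i, i \in A -> i != a -> om i = 1%N) ->
  ((0 < k)%N -> a \in A /\ om a = l) ->
  \sum_(p in wreath_on A) phi (wcl om p) =
  (k`! * #|Gam| ^ k)%:R * feller_mean k l (phi \o blocks).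
Proof.
elim: k A a l om phi => [|k IH] A a l om phi cA phiE om0 om1 aA.
  have A0 : A = finset.set0 by apply/eqP; rewrite -cards_eq0 cA.
  rewrite (big_pred1 1%g) => [|p]; last first.
    apply/wreath_onP/eqP => [[_ pE]|->].
      by apply/permP => x; rewrite perm1 pE// A0 inE.
    by rewrite (group1 wreath_gp); split=> // x _; rewrite perm1.
  rewrite fact0 expn0 mul1r /=; apply: phiE.
  suff -> : [seq v <- wcl om 1%g | (0 < v)%N] = [::] by [].
  apply/eqP; rewrite -size_eq0 size_filter -leqn0 leqNgt -has_count; apply/hasPn.
  by move=> v /mapP[c _ ->]; rewrite big1// => x _; rewrite om0// A0 inE.
have [{}aA oma] := aA isT.
have cAa : #|A :\ a| = k by move: cA; rewrite (cardsD1 a) aA => -[].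
have G0 : #|Gam|%:R != 0 :> R by rewrite pnatr_eq0 -lt0n cardG_gt0.
rewrite (sum_wreath_on _ aA) (bigD1 a)//=.
have -> : \sum_(gam in Gam) \sum_(q in wreath_on (A :\ a)) phi (wcl om (q * wswap a a gam)%g)
  = (k`! * #|Gam| ^ k)%:R *
    \sum_(gam in Gam) feller_mean k 1 (fun t => (phi \o blocks) ((l, gam) :: t)).
  rewrite big_distrr /=; apply: eq_bigr => gam _.
  set phi' := fun s => phi ([seq (l * c)%N | c <- cycle_lengths gam] ++ s).
  set om' := fun i => if i == a then 0%N else om i.
  rewrite (eq_bigr (fun q => phi' (wcl om' q))); last first.
    by move=> q qW; apply: phiE; rewrite -oma; apply: (wcl_close _ _ aA qW).
  (* Any remaining fibre may open the next block; if none remains, the condition on the current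
     fibre is vacuous. *)
  apply: (IH _ (odflt a [pick x in A :\ a])) => //.
  - by move=> s s' ss; apply: phiE; rewrite !filter_cat perm_cat2l.
  - by move=> i; rewrite !inE negb_and negbK /om'; case: eqP => //= _ /om0.
  - by move=> i; rewrite !inE /om' => /andP[/negbTE ia iA] _; rewrite ia om1// ia.
  - rewrite -cAa card_gt0 => /set0Pn[x xA]; case: pickP => /= [y|/(_ x)]; last by rewrite xA.
    by rewrite !inE /om' => /andP[/negbTE ya yA]; rewrite ya yA om1// ya.
have -> : \sum_(b in A | b != a) \sum_(gam in Gam) \sum_(q in wreath_on (A :\ a))
     phi (wcl om (q * wswap a b gam)%g)
  = (k`! * #|Gam| ^ k)%:R * (k%:R * #|Gam|%:R * feller_mean k l.+1 (phi \o blocks)).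
  rewrite (eq_bigr (fun=> #|Gam|%:R * ((k`! * #|Gam| ^ k)%:R *
      feller_mean k l.+1 (phi \o blocks)))).
    rewrite (eq_bigl (mem (A :\ a))) => [|i]; last by rewrite !inE andbC.
    rewrite sumr_const cAa -mulr_natl; ring.
  move=> b /andP[bA ba]; rewrite mulr_natl -sumr_const; apply: eq_bigr => gam _.
  set om' := fun i => if i == a then 0%N else if i == b then (om b + om a)%N else om i.
  rewrite (eq_bigr (fun q => phi (wcl om' q))); last first.
    by move=> q qW; apply: phiE; apply: (wcl_merge _ _ aA ba qW).
  apply: (IH _ b) => //.
  - move=> i; rewrite !inE negb_and negbK /om'; case: eqP => //= _ iA.
    by case: eqP => [ib|_]; [rewrite ib bA in iA|exact: om0].
  - move=> i; rewrite !inE /om' => /andP[/negbTE ia iA] /negbTE ib.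
    by rewrite ia ib om1// ia.
  - by rewrite !inE ba bA /om' (negbTE ba) eqxx om1// oma add1n.
rewrite /= factS expnS !natrM.
have k0 : k.+1%:R != 0 :> R by rewrite pnatr_eq0.
move: (feller_mean _ _ _) => X; move: (\sum_(gam in Gam) _) => Y.
by field; rewrite G0 addrC natr1 k0.
Qed.

End Wreath.

(** * The law of the Feller coupling *)

Section FellerMean.
Variables (m : nat) (Gam : {group {perm 'I_m}}) (R : numFieldType).
Implicit Types (psi : seq (nat * {perm 'I_m}) -> R) (k l : nat).

Let G_neq0 : #|Gam|%:R != 0 :> R.
Proof. by rewrite pnatr_eq0 -lt0n cardG_gt0. Qed.

Fixpoint feller_supp k l : seq (seq (nat * {perm 'I_m})) :=
  if k is k'.+1 then
    [seq (l, gam) :: t | gam <- enum Gam, t <- feller_supp k' 1] ++ feller_supp k' l.+1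
  else [:: [::]].

Lemma eq_in_feller_mean k l psi psi' : {in feller_supp k l, psi =1 psi'} ->
  feller_mean Gam k l psi = feller_mean Gam k l psi'.
Proof.
elim: k l psi psi' => [|k IH] l psi psi' E; first by apply: E; rewrite inE.
rewrite /=; congr ((_ * _ + _ * _) / _).
  apply: eq_bigr => gam gG; apply: IH => t tS; apply: E; rewrite mem_cat.
  by apply/orP; left; apply/allpairsP; exists (gam, t); rewrite mem_enum.
by apply: IH => t tS; apply: E; rewrite mem_cat tS orbT.
Qed.

Lemma feller_meanD k l psi psi' :
  feller_mean Gam k l (fun t => psi t + psi' t) =
  feller_mean Gam k l psi + feller_mean Gam k l psi'.
Proof.
elim: k l psi psi' => [//|k IH] l psi psi' /=; rewrite IH.
rewrite (eq_bigr _ (fun g _ => IH 1%N (fun t => psi ((l, g) :: t)) _)) big_split /=; ring.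
Qed.

Lemma feller_meanZ k l c psi :
  feller_mean Gam k l (fun t => c * psi t) = c * feller_mean Gam k l psi.
Proof.
elim: k l psi => [//|k IH] l psi /=; rewrite IH.
rewrite (eq_bigr _ (fun g _ => IH 1%N (fun t => psi ((l, g) :: t)))) -big_distrr /=; ring.
Qed.

Lemma feller_mean_cst k l (c : R) : feller_mean Gam k l (fun=> c) = c.
Proof.
elim: k l => [//|k IH] l /=; rewrite !IH sumr_const.
have k0 : k.+1%:R != 0 :> R by rewrite pnatr_eq0.
by rewrite -[c *+ _]mulr_natl; field; rewrite G_neq0 addrC natr1 k0.
Qed.

Lemma feller_mean_ge0 k l psi : (forall t, 0 <= psi t) -> 0 <= feller_mean Gam k l psi.
Proof.
elim: k l psi => [|k IH] l psi p0 /=; first exact: p0.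
rewrite divr_ge0// addr_ge0// mulr_ge0 ?invr_ge0 ?ler0n//; last exact: IH.
by apply: sumr_ge0 => g _; apply: IH.
Qed.

Lemma feller_mean_sum (I : Type) (r : seq I) k l (f : I -> seq (nat * {perm 'I_m}) -> R) :
  feller_mean Gam k l (fun t => \sum_(i <- r) f i t) =
  \sum_(i <- r) feller_mean Gam k l (f i).
Proof.
elim: r => [|i r IH].
  by rewrite big_nil -[RHS](feller_mean_cst k l); apply: eq_feller_mean => t; rewrite big_nil.
rewrite big_cons -IH -feller_meanD; apply: eq_feller_mean => t; exact: big_cons.
Qed.

Definition feller_law k (t : seq (nat * {perm 'I_m})) : R :=
  feller_mean Gam k 1 (fun t' => (t' == t)%:R).

Lemma feller_law_ge0 k t : 0 <= feller_law k t.
Proof. by apply: feller_mean_ge0. Qed.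

Lemma feller_law_le1 k t : feller_law k t <= 1.
Proof.
rewrite -subr_ge0 -{1}(feller_mean_cst k 1 1) -mulN1r -feller_meanZ -feller_meanD.
by apply: feller_mean_ge0 => t'; case: eqP => _; rewrite ?mulr1 ?mulr0 ?subrr ?addr0.
Qed.

Lemma feller_mean_law k psi : feller_mean Gam k 1 psi =
  \sum_(t <- undup (feller_supp k 1)) psi t * feller_law k t.
Proof.
rewrite -(eq_bigr _ (fun t _ => feller_meanZ k 1 (psi t) (fun t' => (t' == t)%:R))).
rewrite -feller_mean_sum; apply: eq_in_feller_mean => t tS.
rewrite (bigD1_seq t) ?undup_uniq ?mem_undup//= eqxx mulr1 big1 ?addr0// => t'.
by rewrite eq_sym => /negbTE ->; rewrite mulr0.
Qed.

Lemma feller_meanS k l psi : feller_mean Gam k.+1 l psi =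
  (#|Gam|%:R^-1 * (\sum_(gam in Gam) feller_mean Gam k 1 (fun t => psi ((l, gam) :: t)))
     + k%:R * feller_mean Gam k l.+1 psi) / k.+1%:R.
Proof. by []. Qed.

Lemma feller_law_nil k : feller_law k [::] = (k == 0)%:R.
Proof.
rewrite /feller_law; case: k => [//|k]; elim: k 1%N => [|k IH] l; rewrite feller_meanS.
  by rewrite mul0r addr0 big1 ?mulr0 ?mul0r.
by rewrite IH mulr0 addr0 big1 ?mulr0 ?mul0r// => g _; apply: (feller_mean_cst _ _ 0).
Qed.

(** The first block has uniform length in [1, ..., k] and a uniform mark in [Gam], and the rest is a
    fresh coupling on the remaining points. The sticks are compared with this form of the law. *)
Lemma feller_law_cons k u t : feller_law k (u :: t) =
  if (0 < u.1 <= k)%N && (u.2 \in Gam) then feller_law (k - u.1) t / (k%:R * #|Gam|%:R)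
  else 0.
Proof.
case: u => u1 u2; rewrite /feller_law.
(* Generalized to a block that has reached length [l]: its final length is uniform on
   [l, ..., l + k - 1], since it closes at once with probability [1 / k] and otherwise contributes
   [(k - 1) / k] times [1 / (k - 1)]. *)
suff H l : feller_mean Gam k l (fun t' => (t' == (u1, u2) :: t)%:R) =
    if (l <= u1 < l + k)%N && (u2 \in Gam)
    then feller_law (k + l - u1.+1) t / (k%:R * #|Gam|%:R) else 0.
  by rewrite H add1n ltnS addn1 subSS.
elim: k l => [|k IH] l; first by rewrite addn0 /=; case: ifP => //; lia.
rewrite feller_meanS IH.
have -> : \sum_(gam in Gam) feller_mean Gam k 1 (fun t0 => ((l, gam) :: t0 == (u1, u2) :: t)%:R) =
    ((u1 == l) && (u2 \in Gam))%:R * feller_law k t.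
  have E gam t' : ((l, gam) :: t' == (u1, u2) :: t) =
      [&& u1 == l, gam == u2 & t' == t].
    by rewrite eqseq_cons xpair_eqE andbA [l == _]eq_sym.
  have [uG|uG] := boolP (u2 \in Gam); last first.
    rewrite andbF mul0r big1// => gam gG; rewrite -[RHS](feller_mean_cst k 1 0).
    apply: eq_feller_mean => t'; rewrite E; case: (gam =P u2) => [gu|_]; last by rewrite /= andbF.
    by rewrite gu (negbTE uG) in gG.
  rewrite (bigD1 u2)//= big1 ?addr0; last first.
    move=> gam /andP[gG gu]; rewrite -[RHS](feller_mean_cst k 1 0).
    by apply: eq_feller_mean => t'; rewrite E (negbTE gu) andbF.
  rewrite andbT -feller_meanZ; apply: eq_feller_mean => t'.
  by rewrite E eqxx -natrM mulnb.
have k0 : k.+1%:R != 0 :> R by rewrite pnatr_eq0.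
have [uG|uG] := boolP (u2 \in Gam); last by rewrite !andbF !(mul0r, mulr0, addr0).
rewrite !andbT; case: (ltngtP u1 l) => [ul|ul|ul].
- by rewrite /= !(mul0r, mulr0, addr0).
- rewrite mul0r mulr0 add0r /= (_ : (l.+1 + k = l + k.+1)%N); last by lia.
  case: ifP => ulk; last by rewrite mulr0 mul0r.
  have -> : (k.+1 + l - u1.+1 = k + l.+1 - u1.+1)%N by lia.
  have k1 : k%:R != 0 :> R by rewrite pnatr_eq0; lia.
  by move: (feller_law _ t) => X; field; rewrite G_neq0 k1 addrC natr1 k0.
- rewrite /= mulr0 addr0 mul1r ul addnS ltnS leq_addr.
  have -> : (k.+1 + l - l.+1 = k)%N by lia.
  by move: (feller_law _ t) => X; field; rewrite G_neq0 addrC natr1 k0.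
Qed.

(** With [j] points left a block closes with probability [1 / j], whatever its length and the
    past. *)
Lemma feller_mean_size k l :
  feller_mean Gam k l (fun t => (size t)%:R : R) = \sum_(1 <= j < k.+1) j%:R^-1.
Proof.
elim: k l => [|k IH] l; first by rewrite big_geq.
rewrite feller_meanS IH [RHS]big_nat_recr//=.
rewrite (eq_bigr (fun=> 1 + \sum_(1 <= j < k.+1) j%:R^-1)); last first.
  move=> g _; rewrite -(IH 1%N) -[X in X + _](feller_mean_cst k 1) -feller_meanD.
  by apply: eq_feller_mean => t /=; rewrite -add1n natrD.
have k0 : k.+1%:R != 0 :> R by rewrite pnatr_eq0.
move: (\sum_(_ <= _ < _) _) => X; rewrite sumr_const -[(1 + X) *+ _]mulr_natl.
by field; rewrite G_neq0 addrC natr1 k0.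
Qed.

End FellerMean.

Lemma mean_wreath_feller (m n : nat) (Gam : {group {perm 'I_m}}) (R : numFieldType)
    (phi : seq nat -> R) : (0 < m)%N -> (0 < n)%N ->
  (forall s s', perm_eq [seq v <- s | (0 < v)%N] [seq v <- s' | (0 < v)%N] -> phi s = phi s') ->
  \sum_(p in wreath n Gam) phi (cycle_lengths p) =
  #|wreath n Gam|%:R * \sum_(t <- undup (feller_supp Gam n 1))
     phi (blocks t) * feller_law Gam R n t.
Proof.
case: n => [//|n] m0 _ phiE; rewrite -(feller_mean_law _ _ (phi \o @blocks m)).
have E (f : seq nat -> R) :
    (forall s s', perm_eq [seq v <- s | (0 < v)%N] [seq v <- s' | (0 < v)%N] -> f s = f s') ->
    \sum_(p in wreath n.+1 Gam) f (cycle_lengths p) =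
    (n.+1`! * #|Gam| ^ n.+1)%:R * feller_mean Gam n.+1 1 (f \o @blocks m).
  move=> fE; rewrite -wreath_onT.
  rewrite (eq_bigr (fun p => f (wcl (fun=> 1%N) p))) => [|p _]; last first.
    by congr f; apply: eq_map => c; rewrite sum1_card.
  apply: (@sum_wreath_feller m n.+1 Gam m0 R _ _ ord0); rewrite ?cardsT ?card_ord// => i; by rewrite inE.
rewrite E//; congr (_ * _).
(* The constant function 1 identifies [n! |Gam|^n] with the cardinal of the wreath product. *)
have := E (fun=> 1) (fun _ _ _ => erefl).
rewrite sumr_const (_ : _ \o _ = fun=> 1)// feller_mean_cst mulr1 => <-.
by [].
Qed.

Import numFieldNormedType.Exports.
Local Open Scope classical_set_scope.
Local Open Scope ring_scope.

(** * The binary digits of a uniform number *)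

Section PushRestr.
Local Open Scope ereal_scope.
Context d d' (T1 : measurableType d) (T2 : measurableType d') (R : realType).
Variables (P : {measure set T1 -> \bar R}) (D : set T1) (f : T1 -> T2).
Hypotheses (mD : measurable D) (mf : measurable_fun [set: T1] f).

(** For a fixed event [D] this is a finite measure in [A], so independence statements become
    equalities of measures. The measurability proofs are arguments so that the measure structure can
    be attached to the term. *)
Definition push_restr (_ : measurable D) (_ : measurable_fun [set: T1] f) (A : set T2) : \bar R :=
  P (f @^-1` A `&` D).

Let mfD A : measurable A -> measurable (f @^-1` A `&` D).
Proof. by move=> mA; apply: measurableI => //; rewrite -[X in measurable X]setTI; exact: mf. Qed.

Let push_restr0 : push_restr mD mf set0 = 0.
Proof. by rewrite /push_restr preimage_set0 set0I measure0. Qed.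

Let push_restr_ge0 A : 0 <= push_restr mD mf A. Proof. exact: measure_ge0. Qed.

Let push_restr_sigma : semi_sigma_additive (push_restr mD mf).
Proof.
move=> F mF tF mUF; rewrite /push_restr preimage_bigcup setI_bigcupl.
apply: measure_semi_sigma_additive.
- by move=> n; exact: mfD.
- apply/trivIsetP => /= i j _ _ ij.
  rewrite setIACA -preimage_setI.
  by move/trivIsetP : tF => /(_ _ _ _ _ ij) ->//; rewrite preimage_set0 set0I.
- by rewrite -setI_bigcupl -preimage_bigcup; exact: mfD.
Qed.

HB.instance Definition _ := isMeasure.Build _ _ _ (push_restr mD mf)
  push_restr0 push_restr_ge0 push_restr_sigma.

End PushRestr.

Lemma push_restr_fin d d' (T1 : measurableType d) (T2 : measurableType d') (R : realType)
    (P : probability T1 R) (D : set T1) (f : T1 -> T2) (mD : measurable D)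
    (mf : measurable_fun [set: T1] f) : (push_restr P mD mf setT < +oo)%E.
Proof.
by rewrite /push_restr preimage_setT setTI (le_lt_trans (probability_le1 P mD))// ltry.
Qed.

HB.lock Definition unif01 (R : realType) : probability (measurableTypeR R) R :=
  uniform_prob (@ltr01 R).

Section Uniform01.
Variable R : realType.
Notation rT := (measurableTypeR R).
Notation unif01 := (unif01 R).

(** The distribution function of the uniform law on [[0, 1]]. *)
Definition clip (t : R) : R := Num.max 0 (Num.min t 1).

Lemma clip_le0 t : t <= 0 -> clip t = 0.
Proof. by move=> t0; rewrite /clip max_l// ge_min t0. Qed.

Lemma clip_ge1 t : 1 <= t -> clip t = 1.
Proof. by move=> t1; rewrite /clip min_r// max_r. Qed.

Lemma clip_id t : 0 <= t <= 1 -> clip t = t.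
Proof. by case/andP => t0 t1; rewrite /clip min_l// max_r. Qed.

Lemma clip_ge0 t : 0 <= clip t. Proof. by rewrite /clip le_max lexx. Qed.
Lemma clip_le1 t : clip t <= 1. Proof. by rewrite /clip ge_max ler01 ge_min lexx orbT. Qed.

Lemma unif01E (A : set rT) : measurable A ->
  unif01 A = lebesgue_measure (A `&` `[0, 1]%classic).
Proof.
move=> mA; rewrite unlock /= /uniform_prob integral_uniform_pdf.
rewrite (eq_integral (fun=> 1%:E)) => [|x]; last first.
  rewrite inE => -[_]; rewrite /= in_itv/= /uniform_pdf => ->.
  by rewrite subr0 invr1.
by rewrite integral_cst ?mul1e//; exact: measurableI.
Qed.

Lemma unif01_ray b t : unif01 [set` Interval -oo%O (BSide b t)] = (clip t)%:E.
Proof.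
rewrite unif01E//; have [t0|t0] := ltP t 0.
  rewrite clip_le0 ?ltW// (_ : _ `&` _ = set0) ?measure0//.
  rewrite -subset0 => x [] /=; rewrite !in_itv/=; case: b => /=; lra.
have [t1|t1] := ltP 1 t.
  rewrite clip_ge1 ?ltW// (_ : _ `&` _ = `[0, 1]%classic).
    by rewrite lebesgue_measure_itv/= lte_fin ltr01 oppr0 adde0.
  apply/seteqP; split => x /=; first by case.
  rewrite !in_itv/= => H; split => //; case: b => /=; lra.
rewrite clip_id ?t0//.
rewrite (_ : _ `&` _ = [set` Interval (BLeft 0) (BSide b t)]).
  rewrite lebesgue_measure_itv/= lte_fin oppr0 adde0.
  by case: ltP => // t0'; congr EFin; lra.
apply/seteqP; split => x /=; rewrite !in_itv/=; case: b => /=; try lra.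
Qed.

(** The open left rays are stable under intersection, generate the Borel sets and exhaust the
    line. *)
Lemma measure_ray_unique (m1 m2 : {measure set rT -> \bar R}) :
  (m1 setT < +oo)%E -> (forall t, m1 `]-oo, t[%classic = m2 `]-oo, t[%classic) ->
  forall A, measurable A -> m1 A = m2 A.
Proof.
move=> fin H A; apply: (@measure_unique _ R rT (@RGenInftyO.G R)
  (fun k => `]-oo, k%:R[%classic) (@RGenInftyO.measurableE R)).
- move=> _ _ [x ->] [y ->]; exists (Num.min x y).
  by apply/seteqP; split => z /=; rewrite !in_itv/= lt_min => /andP.
- by move=> i; exists i%:R.
- apply/seteqP; split => // x _; exists (Num.truncn `|x|).+1 => //=.
  by rewrite in_itv/= (le_lt_trans (ler_norm x))// truncnS_gt.
- by move=> _ [x ->].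
- move=> k; apply: le_lt_trans fin; apply: le_measure; rewrite ?inE//.
Qed.

(** The doubling map, which drops the first binary digit of a number of [[0, 1]]; that digit is
    [2^-1 <= x]. *)
Definition dbl (x : R) : R := if x < 2^-1 then 2 * x else 2 * x - 1.

Lemma measurable_dbl : measurable_fun setT (dbl : rT -> rT).
Proof.
apply: measurable_fun_ifT => /=.
- exact: measurable_fun_ltr.
- exact: measurable_funM.
- by apply: measurable_funB => //; exact: measurable_funM.
Qed.

(** Given its first digit, here 0 and in [unif01_dbl_ge] 1, the shifted number is still uniform:
    each branch of [dbl] maps half of the unit interval affinely onto the whole of it. *)
Lemma unif01_dbl_lt (A : set rT) : measurable A ->
  unif01 (dbl @^-1` A `&` [set x | x < 2^-1]) = (2^-1%:E * unif01 A)%E.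
Proof.
have mD : measurable [set x : rT | x < 2^-1].
  by rewrite (_ : [set _ | _] = `]-oo, 2^-1[%classic)//; apply/seteqP; split=> x /=; rewrite in_itv.
have h0 : 0 <= 2^-1 :> R by rewrite invr_ge0.
apply: (@measure_ray_unique (push_restr unif01 mD measurable_dbl)
  (mscale (NngNum h0) unif01)).
  exact: push_restr_fin.
move=> t; transitivity ((2^-1 * clip t)%:E); last by rewrite EFinM -(unif01_ray true t).
rewrite -[LHS]/(unif01 (dbl @^-1` `]-oo, t[%classic `&` [set x | x < 2^-1])).
have [t1|t1] := ltP t 1.
  rewrite (_ : _ `&` _ = `]-oo, t / 2[%classic).
    rewrite unif01_ray; congr EFin.
    have [t0|t0] := leP t 0; first by rewrite !clip_le0; lra.
    by rewrite !clip_id; lra.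
  apply/seteqP; split => x /=; rewrite /dbl !in_itv/=.
    by case=> + h; rewrite h => h'; lra.
  move=> h; have h2 : x < 2^-1 by lra.
  by rewrite h2; split=> //; lra.
rewrite (_ : _ `&` _ = `]-oo, 2^-1[%classic).
  by rewrite unif01_ray (clip_ge1 t1) clip_id; [rewrite mulr1|lra].
apply/seteqP; split => x /=; rewrite /dbl !in_itv/=.
  by case=> + h; rewrite h => h'; lra.
move=> h; have h2 : x < 2^-1 by lra.
by rewrite h2; split=> //; lra.
Qed.

Lemma unif01_dbl_ge (A : set rT) : measurable A ->
  unif01 (dbl @^-1` A `&` [set x | 2^-1 <= x]) = (2^-1%:E * unif01 A)%E.
Proof.
have mD : measurable [set x : rT | 2^-1 <= x].
  by rewrite (_ : [set _ | _] = `[2^-1, +oo[%classic)//; apply/seteqP; split=> x /=; rewrite in_itv/= ?andbT.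
have h0 : 0 <= 2^-1 :> R by rewrite invr_ge0.
apply: (@measure_ray_unique (push_restr unif01 mD measurable_dbl)
  (mscale (NngNum h0) unif01)).
  exact: push_restr_fin.
move=> t; transitivity ((2^-1 * clip t)%:E); last by rewrite EFinM -(unif01_ray true t).
rewrite -[LHS]/(unif01 (dbl @^-1` `]-oo, t[%classic `&` [set x | 2^-1 <= x])).
have [t0|t0] := leP t 0.
  rewrite clip_le0// mulr0 (_ : _ `&` _ = set0) ?measure0//.
  by rewrite -subset0 => x [] /=; rewrite /dbl !in_itv/= => + h; rewrite [x < _]ltNge h /=; lra.
have -> : dbl @^-1` `]-oo, t[ `&` [set x | 2^-1 <= x] =
    `]-oo, (t + 1) / 2[%classic `\` `]-oo, 2^-1[%classic.
  apply/seteqP; split => x /=; rewrite /dbl !in_itv/=.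
    by case=> + h; rewrite [x < _]ltNge h /= => h'; split=> //; lra.
  by case=> h' /negP; rewrite -leNgt => h; rewrite [x < _]ltNge h /=; split=> //; lra.
rewrite measureD//=; last by rewrite unif01_ray ltry.
rewrite setIidr; last by move=> x /=; rewrite !in_itv/=; lra.
rewrite !unif01_ray [in X in (_ - X)%E]clip_id; last by lra.
rewrite -EFinB; congr EFin.
have [t1|t1] := leP t 1; first by rewrite !clip_id; lra.
by rewrite !clip_ge1; lra.
Qed.

Fixpoint digits_sum (k : nat) (x : R) : R :=
  if k is k'.+1 then ((2^-1 <= x)%R%:R + digits_sum k' (dbl (dbl x))) / 2 else 0.

(* [odd_bits x] and [even_bits x] are the numbers in [[0, 1]] whose binary digits are
   the binary digits of [x] of odd rank, respectively of even rank. *)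
Definition odd_bits (x : R) : R := limn (fun k => digits_sum k x).
Definition even_bits (x : R) : R := odd_bits (dbl x).

Lemma digits_sum01 k x : 0 <= digits_sum k x <= 1.
Proof.
elim: k x => [|k IH] x /=; first by rewrite lexx ler01.
have /andP[] := IH (dbl (dbl x)).
by case: (2^-1 <= x) => /=; rewrite ?mulr1n ?mulr0n => h1 h2; apply/andP; split; lra.
Qed.

Lemma digits_sum_cvg x : digits_sum ^~ x @ \oo --> odd_bits x.
Proof.
apply: nondecreasing_is_cvgn.
  apply/nondecreasing_seqP => k; elim: k x => [|k IH] x.
    by have /andP[] := digits_sum01 1 x.
  have E j : digits_sum j.+1 x = ((2^-1 <= x)%R%:R + digits_sum j (dbl (dbl x))) / 2 by [].
  rewrite !E; have := IH (dbl (dbl x)).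
  by move: (digits_sum k _) (digits_sum k.+1 _) => u v; lra.
by exists 1 => _ [k _ <-]; have /andP[] := digits_sum01 k x.
Qed.

Lemma odd_bits_01 x : 0 <= odd_bits x <= 1.
Proof.
apply/andP; split.
  apply: limr_ge; first by apply/cvg_ex; eexists; exact: digits_sum_cvg.
  by near=> k; have /andP[] := digits_sum01 k x.
apply: limr_le; first by apply/cvg_ex; eexists; exact: digits_sum_cvg.
by near=> k; have /andP[] := digits_sum01 k x.
Unshelve. all: by end_near.
Qed.

(** Dropping the first digit exchanges odd and even ranks. *)
Lemma odd_bitsE x : odd_bits x = ((2^-1 <= x)%R%:R + even_bits (dbl x)) / 2.
Proof.
apply/cvg_lim => //; rewrite -cvg_shiftS /=.
apply: cvgM; last exact: cvg_cst.
by apply: cvgD; [exact: cvg_cst|exact: digits_sum_cvg].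
Qed.

Lemma measurable_odd_bits : measurable_fun setT (odd_bits : rT -> rT).
Proof.
apply: (measurable_fun_cvg (h := digits_sum)) => [k|x _]; last exact: digits_sum_cvg.
elim: k => [|k IH]; first exact: measurable_cst.
apply: measurable_funM => //; apply: measurable_funD.
  rewrite (_ : (fun x => _) = (fun x : rT => if 2^-1 <= x then 1 else 0 : R)); last first.
    by apply/funext => x; case: (2^-1 <= x).
  by apply: measurable_fun_ifT => //; exact: measurable_fun_ler.
apply: (measurableT_comp IH).
exact: (measurableT_comp measurable_dbl measurable_dbl).
Qed.

Lemma measurable_even_bits : measurable_fun setT (even_bits : rT -> rT).
Proof. exact: (measurableT_comp measurable_odd_bits measurable_dbl). Qed.

Let quad (s t : R) : set rT := [set x | odd_bits x < s /\ even_bits x < t].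

Let mquad s t : measurable (quad s t).
Proof.
rewrite (_ : quad s t = (odd_bits @^-1` `]-oo, s[) `&` (even_bits @^-1` `]-oo, t[)); last first.
  by apply/seteqP; split => x; rewrite /quad /= !in_itv.
by apply: measurableI; rewrite -[X in measurable X]setTI;
  [exact: measurable_odd_bits|exact: measurable_even_bits].
Qed.

Let F s t : R := fine (unif01 (quad s t)).

Let FE s t : unif01 (quad s t) = (F s t)%:E.
Proof. by rewrite fineK// fin_num_measure//; exact: mquad. Qed.

Let F01 s t : 0 <= F s t <= 1.
Proof. by rewrite -!lee_fin -FE measure_ge0 probability_le1//; exact: mquad. Qed.

(** Conditioning on the first digit [e]: for [x' = dbl x] the two constraints become
    [even_bits x' < 2 s - e] and [odd_bits x' < t], whence the exchange of the arguments. *)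
Let F_rec s t : F s t = (F t (2 * s) + F t (2 * s - 1)) / 2.
Proof.
suff : (F s t)%:E = (2^-1 * F t (2 * s) + 2^-1 * F t (2 * s - 1))%:E.
  by case=> ->; lra.
rewrite -FE EFinD !EFinM -!FE -unif01_dbl_lt// -unif01_dbl_ge//.
rewrite -measureU.
- congr (unif01 _); apply/seteqP; split => x; rewrite /quad /= (odd_bitsE x).
    move=> [h1 h2]; case: (ltP x 2^-1) h1 => h /= h1; [left|right]; do ![split=> //]; lra.
  move=> [[[h1 h2] h]|[[h1 h2] h]]; split=> //; last by rewrite h /=; lra.
  by rewrite leNgt h /=; lra.
- apply: measurableI; first by rewrite -[X in measurable X]setTI; apply: measurable_dbl.
  by rewrite (_ : [set _ | _] = `]-oo, 2^-1[%classic)//; apply/seteqP; split=> x /=; rewrite in_itv.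
- apply: measurableI; first by rewrite -[X in measurable X]setTI; apply: measurable_dbl.
  by rewrite (_ : [set _ | _] = `[2^-1, +oo[%classic)//; apply/seteqP; split=> x /=; rewrite in_itv/= ?andbT.
- by rewrite -subset0 => x [[_ /= h1] [_ /= h2]]; move: h1; rewrite ltNge h2.
Qed.

Let F_le0 s t : s <= 0 -> F s t = 0.
Proof.
move=> s0; rewrite /F (_ : quad s t = set0) ?measure0//.
by rewrite -subset0 => x [/= h _]; have /andP[] := odd_bits_01 x; lra.
Qed.

Let F_le0r s t : t <= 0 -> F s t = 0.
Proof.
move=> s0; rewrite /F (_ : quad s t = set0) ?measure0//.
by rewrite -subset0 => x [/= _ h]; have /andP[] := odd_bits_01 (dbl x); rewrite -/(even_bits x); lra.
Qed.

Let F_gt1r s t t' : 1 < t -> 1 < t' -> F s t = F s t'.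
Proof.
move=> t1 t1'; congr (fine (unif01 _)); apply/seteqP; split=> x [/= h1 _]; split=> //.
  by apply: le_lt_trans t1'; case/andP: (odd_bits_01 (dbl x)).
by apply: le_lt_trans t1; case/andP: (odd_bits_01 (dbl x)).
Qed.

Let F_gt1 s t : 1 < s -> 1 < t -> F s t = 1.
Proof.
move=> s1 t1; rewrite /F (_ : quad s t = setT) ?probability_setT//.
apply/seteqP; split=> x //= _; split.
  by apply: le_lt_trans s1; case/andP: (odd_bits_01 x).
by apply: le_lt_trans t1; case/andP: (odd_bits_01 (dbl x)).
Qed.

Let clip_half s : clip s = (clip (2 * s) + clip (2 * s - 1)) / 2.
Proof.
have [s0|s0] := leP s 0; first by rewrite !clip_le0; lra.
have [s1|s1] := leP 1 s; first by rewrite !clip_ge1; lra.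
have [h|h] := leP (2 * s) 1.
  by rewrite (@clip_le0 (2 * s - 1)) ?(@clip_id s) ?(@clip_id (2 * s)); lra.
by rewrite (@clip_ge1 (2 * s)) ?(@clip_id s) ?(@clip_id (2 * s - 1)); lra.
Qed.

Lemma eq0_geo (x : R) : (forall k, `|x| <= 2^-1 ^+ k) -> x = 0.
Proof.
move=> H; apply/eqP; rewrite -normr_eq0; apply: contraT => x0.
have {}x0 : 0 < `|x| by rewrite lt_neqAle eq_sym x0 normr_ge0.
set k := (Num.truncn `|x|^-1).+1; have k1 : `|x|^-1 < k%:R by exact: truncnS_gt.
have k2 : k%:R < 2 ^+ k :> R by rewrite -natrX ltr_nat ltn_expl.
have := H k; rewrite exprVn leNgt -ltf_pV2 ?posrE ?invr_gt0 ?exprn_gt0//.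
by rewrite invrK (lt_trans k1 k2).
Qed.

(** The threshold 2, like any number above 1, makes a constraint void; the recursion then shows that
    both marginals agree. *)
Let F_marginalr t : F 2 t = F t 2.
Proof. by rewrite F_rec (@F_gt1r t _ 2) ?(@F_gt1r t (2 * 2 - 1) 2); lra. Qed.

(* The self-similarity equation [F_rec] halves the distance between the two sides. *)
Let F_marginal s : F s 2 = clip s.
Proof.
apply/subr0_eq/eq0_geo => k; pose h s := F s 2 - clip s.
have hrec u : h u = (h (2 * u) + h (2 * u - 1)) / 2.
  rewrite /h F_rec !F_marginalr [clip u]clip_half.
  by move: (F _ _) (F _ _) (clip _) (clip _) => a b c d; lra.
have h0 u : u <= 0 -> h u = 0 by move=> u0; rewrite /h F_le0 ?clip_le0 ?subrr.
have h1 u : 1 < u -> h u = 0.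
  by move=> u1; rewrite /h F_gt1 ?clip_ge1 ?subrr ?(ltW u1)//; lra.
rewrite -/(h s); elim: k s => [|k IH] u.
  have /andP[a1 a2] := F01 u 2; have b1 := clip_ge0 u; have b2 := clip_le1 u.
  by rewrite expr0 ler_norml /h; lra.
rewrite hrec exprSr normrM [`|2^-1|]ger0_norm ?invr_ge0// ler_wpM2r ?invr_ge0//.
(* Since [h] vanishes on nonpositive numbers and beyond 1, at most one of the two terms survives;
   this is where the factor [1 / 2] is gained. *)
have [u1|u1] := leP (2 * u) 1; first by rewrite (h0 (2 * u - 1)) ?addr0; last lra.
by rewrite (h1 (2 * u)) ?add0r.
Qed.

(** Independence of the two halves of the digits: the same contraction in two variables, the
    marginals providing the vanishing beyond 1. *)
Let F_clip s t : F s t = clip s * clip t.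
Proof.
apply/subr0_eq/eq0_geo => k; pose g s t := F s t - clip s * clip t.
have grec u v : g u v = (g v (2 * u) + g v (2 * u - 1)) / 2.
  rewrite /g F_rec [clip u]clip_half.
  by field.
have g0r u v : v <= 0 -> g u v = 0 by move=> v0; rewrite /g F_le0r ?(clip_le0 v0) ?mulr0 ?subrr.
have g1 u v : 1 < u -> g u v = 0.
  move=> u1; rewrite /g (clip_ge1 (ltW u1)) mul1r -F_marginal F_rec.
  by rewrite (@F_gt1r v _ 2) ?(@F_gt1r v (2 * u - 1) 2); lra.
have g1r u v : 1 < v -> g u v = 0.
  move=> v1; rewrite /g (clip_ge1 (ltW v1)) mulr1 -F_marginal.
  by rewrite (@F_gt1r u _ 2) ?subrr//; lra.
rewrite -/(g s t); elim: k s t => [|k IH] u v.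
  have /andP[a1 a2] := F01 u v; have b1 := clip_ge0 u; have b2 := clip_le1 u.
  have c1 := clip_ge0 v; have c2 := clip_le1 v.
  have d1 : 0 <= clip u * clip v by rewrite mulr_ge0.
  have d2 : clip u * clip v <= 1 by rewrite mulr_ile1.
  by rewrite expr0 ler_norml /g; lra.
rewrite grec exprSr normrM [`|2^-1|]ger0_norm ?invr_ge0// ler_wpM2r ?invr_ge0//.
have [u1|u1] := leP (2 * u) 1; first by rewrite (g0r v (2 * u - 1)) ?addr0; last lra.
by rewrite (g1r v (2 * u)) ?add0r.
Qed.

Let modd_bits (A : set rT) : measurable A -> measurable (odd_bits @^-1` A : set rT).
Proof. by move=> mA; rewrite -[X in measurable X]setTI; exact: measurable_odd_bits. Qed.

Let meven_bits (A : set rT) : measurable A -> measurable (even_bits @^-1` A : set rT).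
Proof. by move=> mA; rewrite -[X in measurable X]setTI; exact: measurable_even_bits. Qed.

(** One factor is fixed at a time: with [B] a ray both sides are measures in [A] that agree on rays;
    then, with [A] arbitrary, both are measures in [B]. *)
Lemma unif01_bits_rect (A B : set rT) : measurable A -> measurable B ->
  unif01 (odd_bits @^-1` A `&` even_bits @^-1` B) = (unif01 A * unif01 B)%E.
Proof.
move=> mA mB.
have rayB t : unif01 (odd_bits @^-1` A `&` even_bits @^-1` `]-oo, t[) = ((clip t)%:E * unif01 A)%E.
  apply: (@measure_ray_unique (push_restr unif01 (meven_bits (measurable_itv `]-oo, t[)) measurable_odd_bits)
    (mscale (NngNum (clip_ge0 t)) unif01)) => //; first exact: push_restr_fin.
  move=> s; transitivity ((clip t * clip s)%:E); last by rewrite EFinM -(unif01_ray true s).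
  transitivity (unif01 (quad s t)); last by rewrite FE F_clip mulrC.
  rewrite -[LHS]/(unif01 (odd_bits @^-1` `]-oo, s[%classic `&` even_bits @^-1` `]-oo, t[%classic)).
  by congr (unif01 _); apply/seteqP; split => x; rewrite /quad /= !in_itv.
have A0 : 0 <= fine (unif01 A) by apply: fine_ge0; apply: measure_ge0.
have AE : (fine (unif01 A))%:E = unif01 A by rewrite fineK// fin_num_measure.
rewrite setIC; transitivity (mscale (NngNum A0) unif01 B).
  2: by rewrite -[X in _ = (X * _)%E]AE.
apply: (@measure_ray_unique (push_restr unif01 (modd_bits mA) measurable_even_bits)
  (mscale (NngNum A0) unif01)) => //; first exact: push_restr_fin.
move=> t; transitivity ((fine (unif01 A))%:E * (clip t)%:E)%E; last by rewrite -(unif01_ray true t).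
by rewrite AE muleC -rayB setIC.
Qed.

Lemma measurable_bits : measurable_fun setT (fun x : rT => (odd_bits x : rT, even_bits x : rT)).
Proof. by apply/measurable_fun_pairP; split; [exact: measurable_odd_bits|exact: measurable_even_bits]. Qed.

Lemma unif01_bits (X : set (rT * rT)) : measurable X ->
  unif01 [set x | X (odd_bits x, even_bits x)] = (\int[unif01]_u unif01 (xsection X u))%E.
Proof.
move=> mX; transitivity (unif01 ((fun x => (odd_bits x, even_bits x)) @^-1` X `&` setT)).
  by rewrite setIT.
apply/esym; apply: (@product_measure_unique _ _ rT rT R unif01 unif01
  (push_restr unif01 measurableT measurable_bits)) => // A B mA mB.
by rewrite -unif01_bits_rect// -[LHS]/(unif01 (_ `&` setT)) setIT.
Qed.

End Uniform01.

(** * Sticks and lattice points *)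

Section DiscreteMeasurability.
Context d (T : measurableType d) (R : realType).

Definition nat_measurable (f : T -> nat) := forall k, measurable [set x | f x = k].

Lemma nat_measurable_pred2 (f g : T -> nat) (Q : nat -> nat -> Prop) :
  nat_measurable f -> nat_measurable g -> measurable [set x | Q (f x) (g x)].
Proof.
move=> mf mg.
rewrite (_ : [set x | _] = \bigcup_(i in setT) \bigcup_(j in [set j | Q i j])
    ([set x | f x = i] `&` [set x | g x = j])).
  by do 2 apply: bigcup_measurable => ? _; apply: measurableI.
apply/seteqP; split => [x /= Qx|x [i _ [j /= Qij [fx gx]]]]; last by rewrite fx gx.
by exists (f x) => //; exists (g x).
Qed.

Lemma nat_measurable_pred (f : T -> nat) (Q : nat -> Prop) :
  nat_measurable f -> measurable [set x | Q (f x)].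
Proof. by move=> mf; apply: (@nat_measurable_pred2 f f (fun i _ => Q i)). Qed.

Lemma nat_measurable_truncn (f : T -> R) : measurable_fun setT f ->
  nat_measurable (fun x => Num.truncn (f x)).
Proof.
move=> mf k.
have H j : measurable [set x | (j < Num.truncn (f x))%N].
  rewrite (_ : [set x | _] = [set x | j.+1%:R <= f x]); last first.
    by apply/funext => x; rewrite /= truncn_gt_nat.
  by rewrite -[X in measurable X]setTI; apply: measurable_fun_le.
case: k => [|k].
  rewrite (_ : [set x | _] = ~` [set x | (0 < Num.truncn (f x))%N]).
    exact: measurableC.
  by apply/funext => x /=; rewrite propeqE; split=> [->//|/negP]; rewrite -eqn0Ngt => /eqP.
rewrite (_ : [set x | _] = [set x | (k < Num.truncn (f x))%N] `\` [set x | (k.+1 < Num.truncn (f x))%N]).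
  exact: measurableD.
apply/funext => x /=; rewrite propeqE; split => [->|[h /negP]]; first by rewrite ltnn; split.
by rewrite -leqNgt => h2; apply/eqP; rewrite eqn_leq h2.
Qed.

End DiscreteMeasurability.

Lemma bigsetU_seqP (I : eqType) (s : seq I) (T : Type) (F : I -> set T) x :
  (\big[setU/set0]_(i <- s) F i) x <-> exists2 i, i \in s & F i x.
Proof.
elim: s => [|i r IH]; first by rewrite big_nil; split=> // -[].
rewrite big_cons; split=> [[Fx|/IH[j jr Fx]]|[j]].
- by exists i; rewrite ?mem_head.
- by exists j; rewrite // inE jr orbT.
by rewrite inE => /orP[/eqP ->|jr] Fx; [left|right; apply/IH; exists j].
Qed.

Lemma measure_bigsetU_seq (I : eqType) (s : seq I) d (T : measurableType d) (R : realType)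
    (mu : {measure set T -> \bar R}) (F : I -> set T) : uniq s ->
  (forall i, i \in s -> measurable (F i)) ->
  (forall i j x, i \in s -> j \in s -> F i x -> F j x -> i = j) ->
  mu (\big[setU/set0]_(i <- s) F i) = (\sum_(i <- s) mu (F i))%E.
Proof.
elim: s => [|i r IH] /=; first by rewrite !big_nil measure0.
case/andP=> ir ur mF dF; rewrite !big_cons measureU.
- congr (_ + _)%E; apply: IH => // [j jr|j k x jr kr].
  + by apply: mF; rewrite inE jr orbT.
  + by apply: dF; rewrite inE ?jr ?kr orbT.
- by apply: mF; rewrite mem_head.
- rewrite big_seq; apply: bigsetU_measurable => j jr.
  by apply: mF; rewrite inE jr orbT.
- rewrite -subset0 => x [Fi /bigsetU_seqP[j jr Fj]].
  have ij : i = j by apply: (dF _ _ x) => //; rewrite ?mem_head// inE jr orbT.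
  by rewrite ij jr in ir.
Qed.

(** Disjoint events have total mass at most 1, so no lower bound can be strict when the bounds add
    up to 1. *)
Lemma probability_eq_of_ge (I : eqType) (s : seq I) d (T : measurableType d) (R : realType)
    (P : probability T R) (F : I -> set T) (q : I -> R) : uniq s ->
  (forall i, i \in s -> measurable (F i)) ->
  (forall i j x, i \in s -> j \in s -> F i x -> F j x -> i = j) ->
  \sum_(i <- s) q i = 1 -> (forall i, i \in s -> ((q i)%:E <= P (F i))%E) ->
  forall i, i \in s -> P (F i) = (q i)%:E.
Proof.
move=> us mF dF q1 qF i si; apply/eqP; rewrite eq_le qF// andbT.
pose p j := fine (P (F j)).
have pE j : j \in s -> P (F j) = (p j)%:E by move=> sj; rewrite fineK// fin_num_measure//; exact: mF.
have : (\sum_(j <- s) P (F j) <= 1)%E.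
  rewrite -measure_bigsetU_seq//; apply: probability_le1.
  by rewrite big_seq; apply: bigsetU_measurable => j; apply: mF.
rewrite (eq_big_seq (fun j => (p j)%:E))// sumEFin lee_fin pE// lee_fin -{1}q1.
rewrite !(bigD1_seq i)//=.
have : \sum_(j <- s | j != i) q j <= \sum_(j <- s | j != i) p j.
  rewrite big_seq_cond [leRHS]big_seq_cond; apply: ler_sum => j /andP[sj _].
  by rewrite -lee_fin -pE// qF.
lra.
Qed.

Lemma measurable_forall_lt d (T : measurableType d) (E : nat -> set T) N :
  (forall i, measurable (E i)) -> measurable [set w | forall i, (i < N)%N -> E i w].
Proof.
move=> mE; rewrite (_ : [set _ | _] = \bigcap_i [set w | (i < N)%N -> E i w]).
  apply: bigcapT_measurable => i; case: (i < N)%N; last first.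
    by rewrite (_ : [set _ | _] = setT)//; apply/seteqP; split.
  by rewrite (_ : [set _ | _] = E i)//; apply/seteqP; split => w /=; [apply|].
by apply/seteqP; split => w /= Hw i; [move=> _; apply: Hw|apply: Hw].
Qed.

Section PickNth.
Context (R : realType) (X : eqType).
Notation rT := (measurableTypeR R).
Variables (x0 : X) (s : seq X).

(** The cap at [N - 1] assigns the value [v = 1] to the last index. *)
Definition pick_idx (N : nat) (v : R) : nat := minn N.-1 (Num.truncn (v * N%:R)).

Definition pick_nth (v : R) : X := nth x0 s (pick_idx (size s) v).

Let mN N : measurable_fun setT (fun v : rT => v * N%:R).
Proof. exact: measurable_funM. Qed.

Lemma measurable_pick_nth (Q : X -> Prop) : measurable [set v : rT | Q (pick_nth v)].
Proof.
have mi : nat_measurable (fun v : rT => pick_idx (size s) v).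
  have mt := nat_measurable_truncn (mN (size s)).
  by move=> k; apply: (nat_measurable_pred (fun i => minn (size s).-1 i = k) mt).
exact: (nat_measurable_pred (fun i => Q (nth x0 s i)) mi).
Qed.

Lemma unif01_pick_nth x : uniq s -> x \in s ->
  unif01 R [set v | pick_nth v = x] = ((size s)%:R^-1)%:E.
Proof.
move=> us xs; set N := size s; have N0 : (0 < N)%N by rewrite /N; case: (s) xs.
have N0' : 0 < N%:R :> R by rewrite ltr0n.
have ge_idx i : (i < N)%N -> unif01 R [set v | (i <= pick_idx N v)%N] = (1 - i%:R / N%:R)%:E.
  case: i => [|i] iN.
    rewrite (_ : [set _ | _] = setT); first by rewrite probability_setT mul0r subr0.
    by apply/seteqP; split.
  rewrite (_ : [set _ | _] = ~` `]-oo, i.+1%:R / N%:R[); last first.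
    apply/funext => v /=; rewrite in_itv/= propeqE leq_min.
    rewrite truncn_gt_nat (_ : (i < N.-1)%N = true); last by lia.
    by rewrite -ler_pdivrMr//; split => [h|/negP]; [apply/negP|]; rewrite -leNgt.
  rewrite probability_setC//.
  rewrite (unif01_ray true) clip_id// divr_ge0//= ler_pdivrMr// mul1r ler_nat ltnW//.
have mge i : measurable ([set v | (i <= pick_idx N v)%N] : set rT).
  exact: (nat_measurable_pred (fun j => (i <= minn N.-1 j)%N) (nat_measurable_truncn (mN N))).
set i := index x s; have iN : (i < N)%N by rewrite index_mem.
rewrite (_ : [set _ | _] = [set v | (i <= pick_idx N v)%N] `\` [set v | (i.+1 <= pick_idx N v)%N]).
  rewrite measureD//; last by rewrite (le_lt_trans (probability_le1 _ _))// ltry.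
  rewrite setIidr; last by move=> v /=; apply: ltnW.
  rewrite [X in (X - _)%E]ge_idx//; have [iN'|] := ltnP i.+1 N.
    rewrite [X in (_ - X)%E]ge_idx// -EFinB; congr EFin.
    by rewrite -natr1; field; rewrite gt_eqF.
  (* For the last index the cap makes the event of a larger index empty. *)
  move=> Ni; have NE : N = i.+1 by apply/eqP; rewrite eqn_leq Ni iN.
  rewrite [X in (_ - X)%E](_ : _ = 0%E).
    by rewrite sube0 NE; congr EFin; rewrite -natr1; field; rewrite natr1 pnatr_eq0.
  rewrite (_ : [set _ | _] = set0) ?measure0// -subset0 => v /=.
  by rewrite NE leq_min ltnn.
apply/funext => v /=; rewrite propeqE.
have cN : (pick_idx N v < N)%N by rewrite /pick_idx; lia.
split=> [cx|[h /negP h2]].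
  by rewrite /i -cx /pick_nth index_uniq// ltnn; split.
have -> : x = nth x0 s i by rewrite nth_index.
by congr nth; apply/eqP; rewrite eqn_leq h andbT leqNgt.
Qed.

End PickNth.

(** * The stick-breaking process driven by the digits *)

Section StickProcess.
Variables (R : realType) (m : nat) (Gam : {group {perm 'I_m}}).
Notation rT := (measurableTypeR R).
Notation P := (unif01 R).

Lemma preimage_even_bits (B : set rT) : measurable B -> P (@even_bits R @^-1` B) = P B.
Proof.
move=> mB; have := unif01_bits_rect measurableT mB.
by rewrite preimage_setT setTI probability_setT mul1e.
Qed.

Lemma measurable_pre_even_bits (B : set rT) : measurable B -> measurable (@even_bits R @^-1` B : set rT).
Proof. by move=> mB; rewrite -[X in measurable X]setTI; exact: measurable_even_bits. Qed.

Lemma measurable_pre_odd_bits (B : set rT) : measurable B -> measurable (@odd_bits R @^-1` B : set rT).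
Proof. by move=> mB; rewrite -[X in measurable X]setTI; exact: measurable_odd_bits. Qed.

Lemma measurable_pre_bits (X : set (rT * rT)) : measurable X ->
  measurable [set x : rT | X (odd_bits x, even_bits x)].
Proof.
by move=> mX; rewrite -[X in measurable X]setTI; apply: (measurable_bits (R := R)).
Qed.

(** A first-step estimate: a bound on the conditional probability given the odd digits is integrated
    over [A]. *)
Lemma unif01_bits_ge (X : set (rT * rT)) (A : set rT) (c : R) :
  measurable X -> measurable A -> 0 <= c ->
  (forall u, A u -> (c%:E <= P [set r | X (u, r)])%E) ->
  (c%:E * P A <= P [set x | X (odd_bits x, even_bits x)])%E.
Proof.
move=> mX mA c0 H; rewrite unif01_bits//.
have mI : measurable_fun setT (fun x : rT => (\1_A x : R)%:E).
  by apply/measurable_EFinP/measurable_indic.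
have -> : (c%:E * P A = \int[P]_u (c%:E * (\1_A u)%:E))%E.
  rewrite ge0_integralZl//; try exact: mI; try (by move=> u _; rewrite lee_fin).
  by rewrite integral_indic ?setIT.
apply: ge0_le_integral => //=.
- by move=> u _; rewrite mule_ge0// lee_fin.
- exact: emeasurable_funM.
- exact: measurable_fun_xsection.
- move=> u _; rewrite indicE; have [uA|uA] := boolP (u \in A); last by rewrite mule0.
  rewrite mule1 (le_trans (H u _)) ?inE//; first by rewrite inE in uA.
  rewrite (_ : xsection X u = [set r | X (u, r)])//.
  by apply/seteqP; split=> r /=; rewrite /xsection /= inE.
Qed.

Definition pick_gam (v : R) : {perm 'I_m} := pick_nth 1%g (enum Gam) v.

(** The odd digits give [U_i], the odd digits of the even part give [sigma_i], and this is the fresh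
    remainder for the later sticks. *)
Definition stick_next (x : R) : R := even_bits (even_bits x).

Definition stickU (i : nat) (x : R) : R := odd_bits (iter i stick_next x).
Definition stickS (i : nat) (x : R) : {perm 'I_m} := pick_gam (odd_bits (even_bits (iter i stick_next x))).

Lemma stickU_next i x : stickU i.+1 x = stickU i (stick_next x).
Proof. by rewrite /stickU iterSr. Qed.
Lemma stickS_next i x : stickS i.+1 x = stickS i (stick_next x).
Proof. by rewrite /stickS iterSr. Qed.

Lemma measurable_iter_next i : measurable_fun setT (iter i stick_next : rT -> rT).
Proof.
elim: i => [|i IH]; first exact: measurable_id.
apply: (measurableT_comp (measurable_even_bits (R := R))).
exact: (measurableT_comp (measurable_even_bits (R := R)) IH).
Qed.

Lemma stick_ingredients_unif01 : stick_ingredients P Gam stickU stickS.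
Proof.
have mU i : measurable_fun setT (stickU i : rT -> rT).
  exact: (measurableT_comp (measurable_odd_bits (R := R)) (measurable_iter_next i)).
have mS i g : measurable ([set w | stickS i w = g] : set rT).
  have := @measurable_pick_nth R _ 1%g (enum Gam) (eq^~ g).
  move/measurable_pre_odd_bits/measurable_pre_even_bits => H.
  by rewrite -[X in measurable X]setTI; exact: (measurable_iter_next i measurableT H).
split=> //; split=> // N t g; elim: N t g => [|N IH] t g H.
  by rewrite big_ord0 (_ : [set _ | _] = setT) ?probability_setT//; apply/funext => w; rewrite propeqE.
rewrite big_ord_recl.
set A := [set w : rT | forall i, (i < N)%N -> stickU i w <= t i.+1 /\ stickS i w = g i.+1].
have mA : measurable A.
  apply: (measurable_forall_lt (E := fun i => [set w | stickU i w <= t i.+1 /\ stickS i w = g i.+1])) => i.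
  apply: (measurableI [set w | stickU i w <= t i.+1] [set w | stickS i w = g i.+1]); last exact: mS.
  by rewrite -[X in measurable X]setTI; apply: measurable_fun_le => //; exact: mU.
have [/andP[t0 t1] g0] := H 0%N isT.
have -> : [set w | forall i, (i < N.+1)%N -> stickU i w <= t i /\ stickS i w = g i] =
    @odd_bits R @^-1` `]-oo, t 0%N] `&` @even_bits R @^-1`
      (@odd_bits R @^-1` [set v | pick_gam v = g 0%N] `&` @even_bits R @^-1` A).
  apply/seteqP; split => w /= => [Hw|[h1 [h2 h3]] [|i] iN].
  - split; first by rewrite in_itv/=; have [] := Hw 0%N isT.
    split; first by have [] := Hw 0%N isT.
    by move=> i iN; have := Hw i.+1 iN; rewrite stickU_next stickS_next.
  - by rewrite in_itv/= in h1.
  - by rewrite stickU_next stickS_next; apply: h3.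
have mg : measurable ([set v | pick_gam v = g 0%N] : set rT).
  exact: (measurable_pick_nth 1%g (enum Gam) (eq^~ (g 0%N))).
rewrite unif01_bits_rect//; last first.
  by apply: measurableI; [exact: measurable_pre_odd_bits|exact: measurable_pre_even_bits].
rewrite unif01_bits_rect// (unif01_ray false) clip_id ?t0//.
rewrite (@unif01_pick_nth R _ 1%g (enum Gam) (g 0%N)) ?enum_uniq ?mem_enum//.
rewrite (IH (fun i => t i.+1) (fun i => g i.+1)) => [|i iN]; last exact: H.
by rewrite -cardE -!EFinM mulrA.
Qed.

Fixpoint stick_pos (i : nat) (y x : R) : R :=
  if i is i'.+1 then stick_pos i' (y * (1 - odd_bits x)) (stick_next x) else y.

(* The list of the [(L, sigma)] for the successive sticks containing [L > 0]
   lattice points, among the first [M] sticks broken from the right of [[0, y]]. *)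
Fixpoint stick_run (M : nat) (y x : R) : seq (nat * {perm 'I_m}) :=
  if M is M'.+1 then
    let y' := y * (1 - odd_bits x) in
    let s := stick_run M' y' (stick_next x) in
    if (Num.truncn y' < Num.truncn y)%N
    then (Num.truncn y - Num.truncn y', pick_gam (odd_bits (even_bits x)))%N :: s else s
  else [::].

(** Once the position is below 1 no lattice point remains, so the run is final. *)
Definition stick_event (t : seq (nat * {perm 'I_m})) (y : R) : set rT :=
  [set x | exists M, stick_pos M y x < 1 /\ stick_run M y x = t].

Let mtail : measurable_fun setT (fun z : rT * rT => (z.1 * (1 - odd_bits z.2), stick_next z.2) : rT * rT).
Proof.
apply/measurable_fun_pairP; split.
  apply: measurable_funM => //=; apply: measurable_funB => //.
  exact: (measurableT_comp (measurable_odd_bits (R := R))).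
exact: (measurableT_comp (measurable_iter_next 1)).
Qed.

Lemma measurable_stick_pos M : measurable_fun setT (fun z : rT * rT => stick_pos M z.1 z.2 : rT).
Proof.
elim: M => [|M IH]; first exact: measurable_fst.
exact: (measurableT_comp IH mtail).
Qed.

Lemma measurable_stick_run M t : measurable [set z : rT * rT | stick_run M z.1 z.2 = t].
Proof.
elim: M t => [|M IH] t /=.
  case: t => [|u t].
    by rewrite (_ : [set _ | _] = setT)//; apply/seteqP; split.
  by rewrite (_ : [set _ | _] = set0)//; apply/seteqP; split.
have mIH t' : measurable [set z : rT * rT |
    stick_run M (z.1 * (1 - odd_bits z.2)) (stick_next z.2) = t'].
  by rewrite -[X in measurable X]setTI; exact: (mtail measurableT (IH t')).
have my : nat_measurable (fun z : rT * rT => Num.truncn z.1).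
  by apply: nat_measurable_truncn; exact: measurable_fst.
have my' : nat_measurable (fun z : rT * rT => Num.truncn (z.1 * (1 - odd_bits z.2))).
  exact: (nat_measurable_truncn (measurable_stick_pos 1)).
pose lt := [set z : rT * rT | (Num.truncn (z.1 * (1 - odd_bits z.2)) < Num.truncn z.1)%N].
have mlt : measurable lt by exact: (nat_measurable_pred2 (fun i j => (i < j)%N) my' my).
have -> : [set z : rT * rT | (if (Num.truncn (z.1 * (1 - odd_bits z.2)) < Num.truncn z.1)%N
     then (Num.truncn z.1 - Num.truncn (z.1 * (1 - odd_bits z.2)), pick_gam (odd_bits (even_bits z.2)))%N
        :: stick_run M (z.1 * (1 - odd_bits z.2)) (stick_next z.2)
     else stick_run M (z.1 * (1 - odd_bits z.2)) (stick_next z.2)) = t] =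
   (~` lt `&` [set z | stick_run M (z.1 * (1 - odd_bits z.2)) (stick_next z.2) = t]) `|`
   (lt `&` (if t is u :: t' then
      [set z | (Num.truncn z.1 - Num.truncn (z.1 * (1 - odd_bits z.2)))%N = u.1] `&`
      (snd @^-1` (@even_bits R @^-1` (@odd_bits R @^-1` [set v | pick_gam v = u.2])) `&`
      [set z | stick_run M (z.1 * (1 - odd_bits z.2)) (stick_next z.2) = t'])
      else set0)).
  apply/seteqP; split => z; rewrite /lt /=.
    case: ifP => // h; last by left.
    by move=> <- /=; right.
  case=> [[/negP/negbTE ->]//|[->]].
  by case: t => [//|[u1 u2] t /= [<- [<- <-]]].
apply: measurableU; first by apply: measurableI => //; exact: measurableC.
apply: measurableI => //; case: t => [//|u t]; apply: measurableI.
  exact: (nat_measurable_pred2 (fun i j => (j - i)%N = u.1) my' my).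
apply: measurableI => //.
rewrite -[X in measurable X]setTI; apply: measurable_snd => //.
apply: measurable_pre_even_bits; apply: measurable_pre_odd_bits.
exact: (measurable_pick_nth 1%g (enum Gam) (eq^~ u.2)).
Qed.

(** Measurability is joint because, after one step, the starting position is itself a function of
    the digits. *)
Lemma measurable_stick_event2 t : measurable [set z : rT * rT | stick_event t z.1 z.2].
Proof.
rewrite (_ : [set _ | _] = \bigcup_M ([set z : rT * rT | stick_pos M z.1 z.2 < 1] `&`
    [set z : rT * rT | stick_run M z.1 z.2 = t])); last first.
  by apply/seteqP; split=> z [M]; exists M.
apply: bigcup_measurable => M _; apply: measurableI; last exact: measurable_stick_run.
rewrite (_ : [set _ | _] = ~` [set z : rT * rT | 1 <= stick_pos M z.1 z.2]); last first.
  by apply/seteqP; split=> z /=; [move=> h; apply/negP; rewrite -ltNge|move/negP; rewrite -ltNge].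
apply: measurableC; rewrite -[X in measurable X]setTI; apply: measurable_fun_le => //.
exact: measurable_stick_pos.
Qed.

Lemma measurable_stick_event t y : measurable (stick_event t y).
Proof.
have := measurable_xsection (y : rT) (measurable_stick_event2 t).
rewrite (_ : xsection _ _ = stick_event t y)//.
by apply/seteqP; split => x; rewrite /xsection /= inE.
Qed.

Lemma stick_run_lt1 M y x : 0 <= y < 1 -> stick_run M y x = [::].
Proof.
elim: M y x => [//|M IH] y x /andP[y0 y1] /=.
have /andP[b0 b1] := odd_bits_01 x.
have yn0 : 0 <= y * (1 - odd_bits x) by rewrite mulr_ge0// subr_ge0.
have yn1 : y * (1 - odd_bits x) < 1 by rewrite (le_lt_trans _ y1)// ler_piMr//; lra.
have -> : Num.truncn y = 0%N by apply: truncn_def; rewrite y0.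
by rewrite ltn0 IH// yn0.
Qed.

Lemma stick_run_stable M k y x : 0 <= y -> stick_pos M y x < 1 ->
  stick_run (M + k) y x = stick_run M y x.
Proof.
elim: M y x => [|M IH] y x y0; first by move=> y1; rewrite add0n stick_run_lt1// y0.
rewrite addSn /= => p1; rewrite IH//.
by rewrite mulr_ge0// subr_ge0; have /andP[] := odd_bits_01 x.
Qed.

Lemma stick_event_inj t t' y x : 0 <= y -> stick_event t y x -> stick_event t' y x -> t = t'.
Proof.
move=> y0 [M [p1 <-]] [M' [p1' <-]].
by rewrite -(stick_run_stable M' y0 p1) addnC (stick_run_stable M y0 p1').
Qed.

Lemma stick_event_stay t y x :
  (Num.truncn y <= Num.truncn (y * (1 - odd_bits x)))%N ->
  stick_event t (y * (1 - odd_bits x)) (stick_next x) -> stick_event t y x.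
Proof.
by move=> h [M [p1 rE]]; exists M.+1; split=> //=; rewrite ltnNge h /= rE.
Qed.

Lemma stick_event_cut t y x :
  (Num.truncn (y * (1 - odd_bits x)) < Num.truncn y)%N ->
  stick_event t (y * (1 - odd_bits x)) (stick_next x) ->
  stick_event ((Num.truncn y - Num.truncn (y * (1 - odd_bits x)),
    pick_gam (odd_bits (even_bits x)))%N :: t) y x.
Proof.
by move=> h [M [p1 rE]]; exists M.+1; split=> //=; rewrite h /= rE.
Qed.

Lemma unif01_itv (b1 b2 : bool) (a b : R) : 0 <= a -> a <= b -> b <= 1 ->
  P [set` Interval (BSide b1 a) (BSide b2 b)] = (b - a)%:E.
Proof.
move=> a0 ab b1'; rewrite unif01E; last exact: measurable_itv.
rewrite setIidl; last by move=> x /=; rewrite !in_itv/=; case: b1 b2 => -[] /=; lra.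
rewrite lebesgue_measure_itv/= lte_fin; case: ltP => [_|ba]; first by rewrite EFinB.
by congr EFin; lra.
Qed.

Let measurable_event_tail t (y : R) : measurable [set z : rT * rT |
  stick_event t (y * (1 - z.1)) (even_bits z.2)].
Proof.
have mf : measurable_fun setT (fun z : rT * rT => (y * (1 - z.1), even_bits z.2) : rT * rT).
  apply/measurable_fun_pairP; split.
    by apply: measurable_funM => //=; apply: measurable_funB.
  exact: (measurableT_comp (measurable_even_bits (R := R))).
by rewrite -[X in measurable X]setTI; exact: (mf measurableT _ (measurable_stick_event2 t)).
Qed.

(* A fixed point of the first-step recursion on [y in [k, k + 1)]: the stick stays above
   [k] with probability [1 - k / y < 1 / 2], whence the geometric lower bounds. *)
Lemma stick_event_ge t k y : k%:R <= y < k.+1%:R ->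
  ((feller_law Gam R k t)%:E <= P (stick_event t y))%E.
Proof.
elim: t k y => [|[u1 u2] t IH] k y ky.
  rewrite feller_law_nil; case: k ky => [|k] ky; last exact: measure_ge0.
  rewrite (_ : stick_event _ _ = setT) ?probability_setT//.
  by apply/seteqP; split=> // x _; exists 0%N; split=> //=; case/andP: ky.
have [/andP[/andP[/= u10 u1k] u2G]|nu] := boolP ((0 < u1 <= k)%N && (u2 \in Gam)); last first.
  by rewrite feller_law_cons /= (negbTE nu); exact: measure_ge0.
set Q := feller_law Gam R k _; set j := (k - u1)%N.
have G0 : 0 < #|Gam|%:R :> R by rewrite ltr0n cardG_gt0.
have k0 : 1 <= k%:R :> R by rewrite ler1n (leq_trans u10).
have QE : feller_law Gam R j t / #|Gam|%:R = k%:R * Q.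
  by rewrite /Q feller_law_cons /= u10 u1k u2G /= -/j; field; rewrite !gt_eqF//; lra.
have Q0 : 0 <= Q by exact: feller_law_ge0.
have jE : (j + u1 = k)%N by rewrite subnK.
clearbody j; have jk : j%:R + 1 <= k%:R :> R by rewrite natr1 ler_nat; lia.
have step r z : k%:R <= z < k.+1%:R ->
    ((Q * (1 - 2^-1 ^+ r))%:E <= P (stick_event ((u1, u2) :: t) z))%E.
  elim: r z => [|r IHr] z kz; first by rewrite expr0 subrr mulr0; exact: measure_ge0.
  have /andP[kz1 kz2] := kz; have z0 : 0 < z by lra.
  have zk : Num.truncn z = k by apply: truncn_def.
  (* [A1] is the set of [U] whose next position lies in [[j, j + 1)], so that exactly [u1] points
     are cut off; [A2] is the set of [U] whose next position is still at least [k], so that none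
     is. *)
  pose A1 : set rT := `](1 - (j%:R + 1) / z), (1 - j%:R / z)]%classic.
  pose A2 : set rT := `[0, 1 - k%:R / z]%classic.
  pose X1 : set (rT * rT) := (fst @^-1` A1 `&` snd @^-1` (@odd_bits R @^-1` [set v | pick_gam v = u2]))
     `&` [set q | stick_event t (z * (1 - q.1)) (even_bits q.2)].
  pose X2 : set (rT * rT) := fst @^-1` A2
     `&` [set q | stick_event ((u1, u2) :: t) (z * (1 - q.1)) (even_bits q.2)].
  have mA1 : measurable A1 by exact: measurable_itv.
  have mA2 : measurable A2 by exact: measurable_itv.
  have mpick : measurable ([set v | pick_gam v = u2] : set rT).
    exact: (measurable_pick_nth 1%g (enum Gam) (eq^~ u2)).
  have mX1 : measurable X1.
    apply: measurableI; last exact: measurable_event_tail.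
    apply: measurableI; first by rewrite -[X in measurable X]setTI; apply: measurable_fst.
    rewrite -[X in measurable X]setTI; apply: measurable_snd => //.
    exact: measurable_pre_odd_bits.
  have mX2 : measurable X2.
    apply: measurableI; last exact: measurable_event_tail.
    by rewrite -[X in measurable X]setTI; apply: measurable_fst.
  have A1z u : A1 u -> j%:R <= z * (1 - u) < j.+1%:R.
    rewrite /A1 /= in_itv/= => /andP[h1 h2]; rewrite -natr1; apply/andP; split.
      by rewrite mulrC -ler_pdivrMr//; lra.
    by rewrite mulrC -ltr_pdivlMr//; lra.
  have A2z u : A2 u -> k%:R <= z * (1 - u) < k.+1%:R.
    rewrite /A2 /= in_itv/= => /andP[h1 h2]; apply/andP; split.
      by rewrite mulrC -ler_pdivrMr//; lra.
    by apply: le_lt_trans kz2; rewrite ler_piMr ?(ltW z0)//; lra.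
  have P1 : ((k%:R * Q / z)%:E <= P [set x | X1 (odd_bits x, even_bits x)])%E.
    have -> : (k%:R * Q / z)%:E = ((k%:R * Q)%:E * P A1)%E.
      rewrite unif01_itv.
      - by rewrite -EFinM; congr EFin; field; rewrite gt_eqF.
      - by rewrite subr_ge0 ler_pdivrMr//; lra.
      - by rewrite lerD2l lerN2 ler_pM2r ?invr_gt0//; lra.
      - by rewrite gerDl oppr_le0 divr_ge0// ltW.
    apply: unif01_bits_ge => //; first by rewrite mulr_ge0// ler0n.
    move=> u uA; rewrite -QE.
    rewrite (_ : [set r0 | _] = (@odd_bits R @^-1` [set v | pick_gam v = u2]) `&`
        (@even_bits R @^-1` (stick_event t (z * (1 - u))))); last first.
      by apply/seteqP; split=> x /= => [[[_ ?] ?]|[? ?]].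
    rewrite unif01_bits_rect//; last exact: measurable_stick_event.
    rewrite (@unif01_pick_nth R _ 1%g (enum Gam) u2) ?enum_uniq ?mem_enum//.
    rewrite -cardE mulrC EFinM lee_pmul2l ?lte_fin ?invr_gt0//.
    by apply: IH; exact: A1z.
  have P2 : ((Q * (1 - 2^-1 ^+ r) * (1 - k%:R / z))%:E <= P [set x | X2 (odd_bits x, even_bits x)])%E.
    have -> : (Q * (1 - 2^-1 ^+ r) * (1 - k%:R / z))%:E = ((Q * (1 - 2^-1 ^+ r))%:E * P A2)%E.
      rewrite unif01_itv ?subr0 ?EFinM//.
      - by rewrite subr_ge0 ler_pdivrMr//; lra.
      - by rewrite gerDl oppr_le0 divr_ge0// ltW.
    apply: unif01_bits_ge => //.
      by rewrite mulr_ge0// subr_ge0 exprn_ile1// ?invr_ge0// invf_le1//; lra.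
    move=> u uA; rewrite (_ : [set r0 | _] =
        @even_bits R @^-1` (stick_event ((u1, u2) :: t) (z * (1 - u)))); last first.
      by apply/seteqP; split=> x /= => [[_ ?]|?].
    rewrite preimage_even_bits; last exact: measurable_stick_event.
    by apply: IHr; exact: A2z.
  have Xdis : [set x | X1 (odd_bits x, even_bits x)] `&` [set x | X2 (odd_bits x, even_bits x)] = set0.
    rewrite -subset0 => x [/= [[/A1z /= /andP[_ h1] _] _] [/A2z /= /andP[h2 _] _]].
    by move: h1; rewrite -natr1; lra.
  apply: (@le_trans _ _ (P ([set x | X1 (odd_bits x, even_bits x)] `|` [set x | X2 (odd_bits x, even_bits x)]))).
    rewrite measureU//; try exact: measurable_pre_bits.
    apply: le_trans (leeD P1 P2); rewrite -EFinD lee_fin.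
    (* The two contributions add up to [Q - Q 2^-r (1 - k / z)], and [z < k + 1 <= 2 k] makes the
       last factor at most [1 / 2]. *)
    have hk : 1 - k%:R / z <= 2^-1.
      suff : 2^-1 <= k%:R / z by lra.
      rewrite ler_pdivlMr//; move: kz2; rewrite -natr1; lra.
    have e0 : 0 <= 2^-1 ^+ r :> R by rewrite exprn_ge0 ?invr_ge0.
    have := ler_wpM2l (mulr_ge0 Q0 e0) hk; rewrite exprS.
    move: (2^-1 ^+ r) (z^-1) => e w; lra.
  apply: le_measure; rewrite ?inE.
  - by apply: measurableU; exact: measurable_pre_bits.
  - exact: measurable_stick_event.
  move=> x [/= [[/A1z /= xA xp] xe]|[/A2z /= xA xe]].
  - have tE : Num.truncn (z * (1 - odd_bits x)) = j by exact: truncn_def.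
    have := @stick_event_cut t z x; rewrite tE zk -{2}jE addKn xp; apply=> //.
    by rewrite -jE -[ltnLHS]addn0 ltn_add2l.
  - have tE : Num.truncn (z * (1 - odd_bits x)) = k by exact: truncn_def.
    by apply: stick_event_stay => //; rewrite tE zk.
have pE : P (stick_event ((u1, u2) :: t) y) = (fine (P (stick_event ((u1, u2) :: t) y)))%:E.
  by rewrite fineK// fin_num_measure//; exact: measurable_stick_event.
rewrite pE lee_fin -subr_le0; set p := fine _.
have [//|dpos] := leP (Q - p) 0.
suff /eqP : Q - p = 0 by rewrite gt_eqF.
apply: eq0_geo => r; rewrite gtr0_norm//; have := step r y ky; rewrite pE lee_fin -/p.
have e0 : 0 <= 2^-1 ^+ r :> R by rewrite exprn_ge0 ?invr_ge0.
have : Q * 2^-1 ^+ r <= 2^-1 ^+ r by rewrite ler_piMl// feller_law_le1.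
rewrite mulrBr mulr1; lra.
Qed.

Lemma stick_event_law n t : t \in undup (feller_supp Gam n 1) ->
  P (stick_event t n%:R) = (feller_law Gam R n t)%:E.
Proof.
move=> tT.
have sum1 : \sum_(t <- undup (feller_supp Gam n 1)) feller_law Gam R n t = 1.
  rewrite -[RHS](feller_mean_cst Gam n 1 1) feller_mean_law.
  by apply: eq_bigr => t' _; rewrite mul1r.
apply: (probability_eq_of_ge (F := fun t' => stick_event t' n%:R) (undup_uniq _) _ _ sum1 _ tT).
- by move=> t' _; exact: measurable_stick_event.
- by move=> t1 t2 x _ _; apply: stick_event_inj.
- by move=> t' _; apply: stick_event_ge; rewrite lexx ltr_nat /=.
Qed.

End StickProcess.

(** * Nonincreasing rearrangements *)

Section Rearr.
Variable R : realType.

Section Bounded.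
Variables (I : Type) (x : I -> R) (B : R).
Hypothesis xB : forall i, x i <= B.

Let rearr_set k := [set t : R | t = 0 \/ (0 < t /\ exists f : 'I_k.+1 -> I,
  injective f /\ forall j, t <= x (f j))].

Let has_sup_rearr k : has_sup (rearr_set k).
Proof.
split; first by exists 0; left.
exists (Num.max 0 B) => t [->|[_ [f [_ /(_ ord0) tx]]]]; rewrite le_max ?lexx//.
by apply/orP; right; apply: le_trans tx _.
Qed.

Lemma rearr_ge0 k : 0 <= rearr x k.
Proof. by apply: ub_le_sup; [case: (has_sup_rearr k)|left]. Qed.

Lemma rearr_ge k t (f : 'I_k.+1 -> I) : injective f -> (forall j, t <= x (f j)) ->
  t <= rearr x k.
Proof.
move=> fI tx; have [t0|t0] := leP t 0; first exact: le_trans t0 (rearr_ge0 k).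
by apply: ub_le_sup; [case: (has_sup_rearr k)|right; split=> //; exists f].
Qed.

Lemma rearr_le k b : 0 <= b ->
  (forall t (f : 'I_k.+1 -> I), 0 < t -> injective f -> (forall j, t <= x (f j)) -> t <= b) ->
  rearr x k <= b.
Proof.
move=> b0 H; apply: sup_le_ub; first by case: (has_sup_rearr k).
by move=> t [->//|[t0 [f [fI tx]]]]; apply: H tx.
Qed.

Lemma rearr_gt k t : 0 <= t -> t < rearr x k ->
  exists f : 'I_k.+1 -> I, injective f /\ forall j, t < x (f j).
Proof.
move=> t0 tr; have [u us tu] := sup_gt (ex_intro _ 0 (or_introl erefl) : nonempty (rearr_set k)) tr.
case: us tu => [->|[u0 [f [fI ux]]]] tu; first by exfalso; lra.
by exists f; split=> // j; apply: lt_le_trans (ux j).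
Qed.

End Bounded.

(** The [k + 1] indices at which [x] is at least [t] also witness the level [t - e] for [y]. *)
Lemma rearr_shift (I : Type) (x y : I -> R) (B e : R) k : (forall i, x i <= B) ->
  (forall i, y i <= B) -> 0 <= e -> (forall i, x i <= y i + e) ->
  rearr x k <= rearr y k + e.
Proof.
move=> xB yB e0 xy; apply: (rearr_le xB); first by rewrite addr_ge0// (rearr_ge0 yB).
move=> t f _ fI tx; rewrite -lerBlDr; apply: (rearr_ge yB fI) => j.
by rewrite lerBlDr (le_trans (tx j)).
Qed.

Lemma le_rearr (I : Type) (x y : I -> R) (B : R) k : (forall i, y i <= B) ->
  (forall i, x i <= y i) -> rearr x k <= rearr y k.
Proof.
move=> yB xy; rewrite -[leRHS]addr0; apply: (rearr_shift (B := B)) => // i.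
  exact: le_trans (xy i) (yB i).
by rewrite addr0.
Qed.

Lemma rearr_lip (I : Type) (x y : I -> R) (B e : R) k : (forall i, x i <= B) ->
  (forall i, y i <= B) -> 0 <= e -> (forall i, `|x i - y i| <= e) ->
  `|rearr x k - rearr y k| <= e.
Proof.
move=> xB yB e0 xy; rewrite ler_distl; apply/andP; split.
  rewrite lerBlDr; apply: (rearr_shift (B := B)) => // i.
  by have := xy i; rewrite ler_distl => /andP[]; rewrite lerBlDr.
by apply: (rearr_shift (B := B)) => // i; have := xy i; rewrite ler_distl => /andP[].
Qed.

Section FiniteSupport.
Variables (I : eqType) (x : I -> R) (r : seq I).
Hypotheses (ur : uniq r) (xr : forall i, 0 < x i -> i \in r).

Definition sorted_values : seq R := sort >=%R [seq v <- [seq x i | i <- r] | 0 < v].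

Lemma rearr_sorted k : rearr x k = nth 0 sorted_values k.
Proof.
set r' := [seq i <- r | 0 < x i]; pose l := sort (fun i j => x j <= x i) r'.
have LE : sorted_values = [seq x i | i <- l].
  rewrite /sorted_values filter_map; apply/esym.
  exact: (@map_sort _ _ x (fun i j => x j <= x i) >=%R (fun _ _ => erefl) r').
have lP i : (i \in l) = (0 < x i).
  rewrite mem_sort mem_filter; case: (ltP 0 (x i)) => // /xr ->; by [].
have ul : uniq l by rewrite sort_uniq filter_uniq.
have sl : sorted (fun i j => x j <= x i) l by apply: sort_sorted => i j; apply: le_total.
have ltr : transitive (fun i j => x j <= x i) by move=> i j h /[swap]; apply: le_trans.
have le_nth i0 a b : (a <= b < size l)%N -> x (nth i0 l b) <= x (nth i0 l a).
  case/andP => ab bl; have [->//|nab] := eqVneq a b.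
  apply: (sorted_ltn_nth ltr) => //; rewrite ?inE//; first exact: leq_ltn_trans bl.
  by rewrite ltn_neqAle nab.
have [B xB] : exists B, forall i, x i <= B.
  exists (\sum_(i <- l) x i) => i; have [il|il] := boolP (i \in l).
    rewrite (bigD1_seq i)//= lerDl big_seq_cond sumr_ge0// => j /andP[].
    by rewrite lP => /ltW.
  rewrite (@le_trans _ _ 0)//; first by rewrite leNgt -lP.
  by rewrite big_seq sumr_ge0// => j; rewrite lP => /ltW.
apply/eqP; rewrite eq_le; apply/andP; split.
  apply: (rearr_le xB).
    have [kl|kl] := ltnP k (size sorted_values); last by rewrite nth_default.
    have : nth 0 sorted_values k \in sorted_values by rewrite mem_nth.
    by rewrite mem_sort mem_filter => /andP[/ltW].
  move=> t f t0 fI tx.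
  have fl j : f j \in l by rewrite lP (lt_le_trans t0).
  (* Pigeonhole: among [k + 1] distinct indices of the sorted list one has rank at least [k]. *)
  have [j kj] : exists j, (k <= index (f j) l)%N.
    apply: contrapT => H.
    have H' j : (index (f j) l < k)%N by rewrite ltnNge; apply/negP => ?; apply: H; exists j.
    have : injective (fun j => Ordinal (H' j)).
      by move=> a b [] /(congr1 (nth (f a) l)); rewrite !nth_index//; apply: fI.
    by move/leq_card; rewrite !card_ord ltnn.
  have il : (index (f j) l < size l)%N by rewrite index_mem.
  have kl := leq_ltn_trans kj il.
  rewrite LE (nth_map (f j))// (le_trans (tx j))// -{1}(nth_index (f j) (fl j)).
  by apply: le_nth; rewrite kj.
have [kl|kl] := ltnP k (size sorted_values); last by rewrite nth_default// (rearr_ge0 xB).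
have {}kl : (k < size l)%N by rewrite LE size_map in kl.
have i0 : I by case: (l) kl.
rewrite LE (nth_map i0)//; apply: (@rearr_ge _ _ _ xB k _ (fun j : 'I_k.+1 => nth i0 l j)).
  move=> a b /eqP; rewrite nth_uniq ?(leq_ltn_trans _ kl)// ?leq_ord//.
  by move/eqP/val_inj.
by move=> j; apply: le_nth; rewrite leq_ord.
Qed.

Hypothesis x0 : forall i, 0 <= x i.

Lemma sum_sorted_values : \sum_(v <- sorted_values) v = \sum_(i <- r) x i.
Proof.
rewrite (perm_big _ (permEl (perm_sort _ _))) /= big_filter big_map big_mkcond /=.
by apply: eq_bigr => i _; case: ltP => // xi; apply/le_anti; rewrite xi x0.
Qed.

Lemma sum_rearr_le K : \sum_(k < K) rearr x k <= \sum_(i <- r) x i.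
Proof.
rewrite -sum_sorted_values (big_nth 0) big_mkord.
under eq_bigr do rewrite rearr_sorted.
have nn k : 0 <= nth 0 sorted_values k.
  have [kl|kl] := ltnP k (size sorted_values); last by rewrite nth_default.
  have : nth 0 sorted_values k \in sorted_values by rewrite mem_nth.
  by rewrite mem_sort mem_filter => /andP[/ltW].
rewrite -!(big_mkord xpredT (fun k => nth 0 sorted_values k)).
have [Ks|Ks] := leqP K (size sorted_values).
  by rewrite [leRHS](@big_cat_nat _ _ _ K)//= lerDl sumr_ge0.
rewrite (@big_cat_nat _ _ _ (size sorted_values))//=; last exact: ltnW.
rewrite [X in _ + X]big_nat_cond [X in _ + X]big1 ?addr0// => k /andP[/andP[sk _] _].
by rewrite nth_default.
Qed.

Lemma sum_rearr K : (size r <= K)%N -> \sum_(k < K) rearr x k = \sum_(i <- r) x i.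
Proof.
move=> rK; rewrite -sum_sorted_values (big_nth 0) big_mkord.
under eq_bigr do rewrite rearr_sorted.
have sK : (size sorted_values <= K)%N.
  by rewrite size_sort size_filter (leq_trans (count_size _ _))// size_map.
rewrite -!(big_mkord xpredT (fun k => nth 0 sorted_values k)).
rewrite (@big_cat_nat _ _ _ (size sorted_values))//=.
rewrite [X in _ + X]big_nat_cond [X in _ + X]big1 ?addr0// => k /andP[/andP[sk _] _].
by rewrite nth_default.
Qed.

End FiniteSupport.

Lemma eq_rearr_perm (I J : eqType) (x : I -> R) (y : J -> R) (r : seq I) (s : seq J) k :
  uniq r -> uniq s -> (forall i, 0 < x i -> i \in r) -> (forall j, 0 < y j -> j \in s) ->
  perm_eq [seq v <- [seq x i | i <- r] | 0 < v] [seq v <- [seq y j | j <- s] | 0 < v] ->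
  rearr x k = rearr y k.
Proof.
move=> ur us xr ys p; rewrite (rearr_sorted ur xr) (rearr_sorted us ys); congr nth.
apply/perm_sortP => //; first exact: ge_total; [exact: ge_trans|exact: ge_anti].
Qed.

(** * The sum of the differences of two rearrangements *)

Section L1.
Variables (I : eqType) (a c : I -> R) (r : seq I).
Hypotheses (ur : uniq r) (cr : forall i, 0 < c i -> i \in r).
Hypotheses (a0 : forall i, 0 <= a i) (c0 : forall i, 0 <= c i).
Hypothesis sum_a : forall s, uniq s -> \sum_(i <- s) a i <= 1.

Let a1 i : a i <= 1.
Proof. by have := sum_a (s := [:: i]) isT; rewrite big_seq1. Qed.

(* Up to [e], finitely many entries suffice to build the first [K] terms. *)
Let sum_rearr_a K : \sum_(k < K) rearr a k <= 1.
Proof.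
suff H e : 0 < e -> \sum_(k < K) rearr a k <= 1 + K%:R * e.
  apply/ler_addgt0Pr => e e0; case: K H => [|K] H; first by rewrite big_ord0 addr_ge0 ?ltW.
  have K0 : 0 < K.+1%:R :> R by [].
  by have := H (e / K.+1%:R) (divr_gt0 e0 K0); rewrite mulrC divfK ?gt_eqF.
move=> e0.
have ex (k : 'I_K) : exists s : seq I, forall s' : seq I, {subset s <= s'} ->
    rearr a k <= rearr (fun i => if i \in s' then a i else 0) k + e.
  have b1 (s' : seq I) i : (if i \in s' then a i else 0) <= 1 by case: ifP.
  have [h|h] := leP (rearr a k) e.
    by exists [::] => s' _; rewrite (le_trans h)// lerDr (rearr_ge0 (b1 s')).
  have [] := rearr_gt (x := a) (k := k) (t := rearr a k - e); first by rewrite subr_ge0 ltW.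
    by rewrite gtrBl.
  move=> f [fI fx]; exists (codom f) => s' ss'; rewrite -lerBlDr.
  by apply: (rearr_ge (b1 s') fI) => j; rewrite ss' ?codom_f// ltW.
have /choice[s sP] := ex; pose s' := undup (flatten [seq s k | k <- enum 'I_K]).
pose a' i := if i \in s' then a i else 0.
have a's i : 0 < a' i -> i \in s' by rewrite /a'; case: ifP => //; rewrite ltxx.
have a'0 i : 0 <= a' i by rewrite /a'; case: ifP.
have us' : uniq s' by exact: undup_uniq.
apply: (@le_trans _ _ (\sum_(k < K) (rearr a' k + e))).
  apply: ler_sum => k _; apply: sP => i ik; rewrite mem_undup.
  by apply/flattenP; exists (s k) => //; apply/mapP; exists k; rewrite ?mem_enum.
rewrite big_split /= sumr_const card_ord -[e *+ K]mulr_natl lerD2r.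
rewrite (le_trans (sum_rearr_le us' a's a'0 K))// (le_trans _ (sum_a us'))//.
by rewrite big_seq [leRHS]big_seq ler_sum// => i si; rewrite /a' si.
Qed.

Hypothesis sum_c : \sum_(i <- r) c i = 1.

(** Both rearrangements dominate that of [u = min(c, a)], so [|C - A| <= C + A - 2 W] termwise, with
    [W] the rearrangement of [u]. Unlike [a], both [c] and [u] have finite support and keep their
    sums under rearrangement. *)
Lemma rearr_L1 K :
  \sum_(k < K) `|rearr c k - rearr a k| <= 2 * \sum_(i <- r) Num.max 0 (c i - a i).
Proof.
pose u i := Num.min (c i) (a i).
have u0 i : 0 <= u i by rewrite le_min c0 a0.
have ur' i : 0 < u i -> i \in r by rewrite lt_min => /andP[/cr].
have cB i : c i <= 1.
  have [ir|ir] := boolP (i \in r).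
    by rewrite -sum_c (bigD1_seq i)//= lerDl sumr_ge0.
  by rewrite (@le_trans _ _ 0)// leNgt; apply: contra ir => /cr.
have uc k : rearr u k <= rearr c k by apply: (le_rearr (B := 1)) => // i; rewrite ge_min lexx.
have ua k : rearr u k <= rearr a k by apply: (le_rearr (B := 1)) => // i; rewrite ge_min lexx orbT.
(* Enough terms to exhaust the supports of [c] and [u]. *)
pose K' := maxn K (size r).
apply: (@le_trans _ _ (\sum_(k < K') `|rearr c k - rearr a k|)).
  rewrite -!(big_mkord xpredT (fun k => `|rearr c k - rearr a k|)).
  by rewrite [leRHS](@big_cat_nat _ _ _ K)//= ?leq_maxl// lerDl sumr_ge0.
(* The subtracted sum is nonnegative, since [c] has mass 1 and [a] at most 1. *)
apply: (@le_trans _ _ (\sum_(k < K') (2 * (rearr c k - rearr u k) - (rearr c k - rearr a k)))).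
  apply: ler_sum => k _; have := uc k; have := ua k.
  by case: (lerP (rearr a k) (rearr c k)) => ?; lra.
rewrite sumrB -mulr_sumr !sumrB.
rewrite (sum_rearr ur cr c0) ?leq_maxr// (sum_rearr ur ur' u0) ?leq_maxr//.
have -> : \sum_(i <- r) Num.max 0 (c i - a i) = \sum_(i <- r) c i - \sum_(i <- r) u i.
  rewrite -sumrB; apply: eq_bigr => i _; rewrite /u.
  by case: (lerP (c i) (a i)) => h; [rewrite max_l|rewrite max_r]; lra.
have := sum_rearr_a K'; rewrite sum_c; lra.
Qed.

End L1.

End Rearr.

(** * Matching the parts of the two partitions *)

Lemma sumn_cycle_lengths (T : finType) (p : {perm T}) :
  (\sum_(l <- cycle_lengths p) l)%N = #|T|.
Proof.
rewrite /cycle_lengths big_map big_enum /= -sum1_card.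
rewrite [RHS](partition_big (porbit p) (mem (porbits p))) /=; last first.
  by move=> x _; apply: imset_f.
apply: eq_bigr => c /imsetP[y _ ->]; rewrite -sum1_card.
by apply: eq_bigl => x; rewrite eq_porbit_mem.
Qed.

Lemma sum_nth_le (s : seq nat) K : (\sum_(j < K) nth 0 s j <= \sum_(v <- s) v)%N.
Proof.
elim: s K => [|v s IH] K; first by rewrite big_nil big1// => j _; rewrite nth_nil.
by case: K => [|K]; rewrite ?big_ord0// big_ord_recl big_cons leq_add2l.
Qed.

Lemma ler_sum_sub (R : numDomainType) (I : eqType) (s t : seq I) (f : I -> R) :
  uniq s -> uniq t -> {subset s <= t} -> (forall i, 0 <= f i) ->
  \sum_(i <- s) f i <= \sum_(i <- t) f i.
Proof.
move=> us ut st f0; rewrite [leRHS](bigID (mem s))/=.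
have pe : perm_eq [seq i <- t | i \in s] s.
  apply: uniq_perm; rewrite ?filter_uniq// => i; rewrite mem_filter.
  by case: (boolP (i \in s)) => //= /st.
rewrite -[X in _ <= X + _]big_filter (perm_big _ pe) /=.
by rewrite lerDl sumr_ge0.
Qed.

Lemma filter_flatten_map (I T : Type) (r : seq I) (b : pred I) (P : pred T) (f : I -> seq T) :
  (forall i, ~~ b i -> [seq v <- f i | P v] = [::]) ->
  [seq v <- flatten [seq f i | i <- r] | P v] =
  [seq v <- flatten [seq f i | i <- [seq i <- r | b i]] | P v].
Proof.
move=> H; elim: r => [//|i r IH] /=; rewrite filter_cat IH.
by case: ifP => [bi|/negbT/H -> //]; rewrite /= filter_cat.
Qed.

Lemma map_iota_nth (T : Type) (f g : nat -> T) (s : seq nat) :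
  (forall j, f j = g (nth 0 s j)) -> [seq f j | j <- iota 0 (size s)] = [seq g l | l <- s].
Proof.
by move=> fg; rewrite -[in RHS](mkseq_nth 0 s) /mkseq -map_comp; apply: eq_map.
Qed.

Section PartB.
Variables (R : realType) (m : nat) (sig : {perm 'I_m}).
Hypothesis m_gt0 : (0 < m)%N.

Lemma partB_ge0 j : 0 <= partB R sig j.
Proof. by rewrite divr_ge0. Qed.

Lemma sum_partB_le K : \sum_(j < K) partB R sig j <= 1.
Proof.
rewrite -mulr_suml -natr_sum ler_pdivrMr ?ltr0n// mul1r ler_nat.
by rewrite (leq_trans (sum_nth_le _ _))// sumn_cycle_lengths card_ord.
Qed.

Lemma partB_le1 j : partB R sig j <= 1.
Proof.
rewrite (le_trans _ (sum_partB_le j.+1))// big_ord_recr/= lerDr sumr_ge0// => i _.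
exact: partB_ge0.
Qed.

End PartB.

Section Stick.
Variables (R : realType) (U : nat -> R).
Hypothesis U01 : forall i, 0 <= U i <= 1.

Lemma stick_ge0 i : 0 <= stick U i.
Proof.
rewrite /stick mulr_ge0//; first by case/andP: (U01 i).
by rewrite prodr_ge0// => r _; rewrite subr_ge0; case/andP: (U01 r).
Qed.

Lemma stickE i : stick U i = \prod_(r < i) (1 - U r) - \prod_(r < i.+1) (1 - U r).
Proof. by rewrite big_ord_recr/= /stick; ring. Qed.

Lemma sum_stick_le N : \sum_(i < N) stick U i <= 1.
Proof.
suff -> : \sum_(i < N) stick U i = 1 - \prod_(r < N) (1 - U r).
  by rewrite gerBl prodr_ge0// => r _; rewrite subr_ge0; case/andP: (U01 r).
elim: N => [|N IH]; first by rewrite !big_ord0 subrr.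
by rewrite big_ord_recr/= IH stickE; ring.
Qed.

Variables (m : nat) (S : nat -> {perm 'I_m}).
Hypothesis m_gt0 : (0 < m)%N.

Lemma partA_ge0 ij : 0 <= partA U S ij.
Proof. by rewrite mulr_ge0 ?stick_ge0 ?partB_ge0. Qed.

Lemma sum_partA_le s : uniq s -> \sum_(ij <- s) partA U S ij <= 1.
Proof.
move=> us; pose N := (\max_(ij <- s) ij.1).+1; pose K := (\max_(ij <- s) ij.2).+1.
rewrite (le_trans (ler_sum_sub us (t := [seq (i, j) | i <- iota 0 N, j <- iota 0 K]) _ _ partA_ge0))//.
- by rewrite allpairs_uniq ?iota_uniq// => -[i j] [i' j'] _ _.
- move=> [i j] ijs; apply/allpairsP; exists (i, j); rewrite !mem_iota/= !add0n !ltnS.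
  by split=> //; [exact: (@leq_bigmax_seq _ s xpredT fst (i, j) ijs isT)|exact: (@leq_bigmax_seq _ s xpredT snd (i, j) ijs isT)].
rewrite big_allpairs_dep/=; apply: le_trans (sum_stick_le N).
rewrite -[leRHS](big_mkord xpredT (stick U)) /index_iota subn0.
apply: ler_sum => i _; rewrite /partA/= -mulr_sumr ler_piMr ?stick_ge0//.
have := sum_partB_le R (S i) m_gt0 K.
by rewrite -[leLHS](big_mkord xpredT (partB R (S i))) /index_iota subn0.
Qed.

End Stick.

Section StickPos.
Variables (R : realType) (m : nat) (Gam : {group {perm 'I_m}}).
Implicit Types (x y : R).

Lemma stickU01 i x : 0 <= stickU i x <= 1.
Proof. exact: odd_bits_01. Qed.

Lemma stick_posE i y x : stick_pos i y x = y * \prod_(r < i) (1 - stickU r x).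
Proof.
elim: i y x => [|i IH] y x; first by rewrite big_ord0 mulr1.
rewrite /= IH big_ord_recl -mulrA; congr (_ * (_ * _)).
by apply: eq_bigr => r _; rewrite -stickU_next.
Qed.

Lemma stick_pos_ge0 i y x : 0 <= y -> 0 <= stick_pos i y x.
Proof.
move=> y0; rewrite stick_posE mulr_ge0// prodr_ge0// => r _.
by rewrite subr_ge0; case/andP: (stickU01 r x).
Qed.

Lemma stick_pos_le i y x : 0 <= y -> stick_pos i.+1 y x <= stick_pos i y x.
Proof.
move=> y0; rewrite !stick_posE big_ord_recr/= mulrA ler_piMr//.
  by rewrite -stick_posE stick_pos_ge0.
by rewrite gerBl; case/andP: (stickU01 i x).
Qed.

Definition stick_pts y x i : nat :=
  (Num.truncn (stick_pos i y x) - Num.truncn (stick_pos i.+1 y x))%N.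

Lemma stick_runE M y x : stick_run Gam M y x =
  [seq (stick_pts y x i, stickS Gam i x) | i <- iota 0 M & (0 < stick_pts y x i)%N].
Proof.
elim: M y x => [//|M IH] y x.
rewrite [LHS]/= IH [iota 0 M.+1]/= (iotaDl 1 0 M).
have E : [seq (stick_pts y x i, stickS Gam i x) | i <- [seq (1 + i)%N | i <- iota 0 M] & (0 < stick_pts y x i)%N]
    = [seq (stick_pts (y * (1 - odd_bits x)) (stick_next x) i, stickS Gam i (stick_next x))
      | i <- iota 0 M & (0 < stick_pts (y * (1 - odd_bits x)) (stick_next x) i)%N].
  rewrite filter_map -map_comp; apply/eq_map => i /=.
  by rewrite add1n stickS_next.
have h0 : (0 < stick_pts y x 0)%N = (Num.truncn (y * (1 - odd_bits x)) < Num.truncn y)%N.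
  by rewrite /stick_pts /= subn_gt0.
by rewrite -[0%N :: _]cat1s filter_cat map_cat E /= h0; case: ifP.
Qed.

(** The error is a difference of two fractional parts. *)
Lemma stick_pts_dist y x i : 0 <= y ->
  `|(stick_pts y x i)%:R - (stick_pos i y x - stick_pos i.+1 y x)| <= 1.
Proof.
move=> y0; have p0 j : 0 <= stick_pos j y x by exact: stick_pos_ge0.
rewrite /stick_pts natrB; last by apply: le_truncn; exact: stick_pos_le.
have /andP[] := truncn_itv (p0 i); have /andP[] := truncn_itv (p0 i.+1).
rewrite -!natr1 => *; rewrite ler_distl; lra.
Qed.

End StickPos.

(** * Comparison of the two partitions for a given run *)

Section Matching.
Variables (R : realType) (m n : nat) (Gam : {group {perm 'I_m}}).
Hypotheses (m_gt0 : (0 < m)%N) (n_gt0 : (0 < n)%N).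
Variables (x : R) (t : seq (nat * {perm 'I_m})) (p : {perm 'I_n * 'I_m}).
Hypothesis tx : stick_event Gam t n%:R x.
Hypothesis pt : perm_eq [seq v <- cycle_lengths p | (0 < v)%N] [seq v <- blocks t | (0 < v)%N].

Let a := partA (fun i => stickU i x) (fun i => stickS Gam i x).
Let L i := stick_pts n%:R x i.
Let st i := stick (fun i => stickU i x) i.
(** The intermediate family: indexed like [partA], with each stick length replaced by its share of
    the lattice points. It has the same rearrangement as [partC] and is compared with [a] index by
    index. *)
Let c (ij : nat * nat) : R := (L ij.1)%:R / n%:R * partB R (stickS Gam ij.1 x) ij.2.
Let sc (l : nat) : R := l%:R / (m * n)%:R.

Let n0 : 0 < n%:R :> R. Proof. by rewrite ltr0n. Qed.
Let m0 : 0 < m%:R :> R. Proof. by rewrite ltr0n. Qed.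

Let L_st i : `|(L i)%:R / n%:R - st i| <= n%:R^-1.
Proof.
have := @stick_pts_dist R n%:R x i (ltW n0).
have -> : stick_pos i n%:R x - stick_pos i.+1 n%:R x = n%:R * st i.
  by rewrite /st stickE !stick_posE; ring.
rewrite -(ler_pM2r (x := n%:R^-1)) ?invr_gt0// mul1r.
have -> : (L i)%:R / n%:R - st i = ((stick_pts n%:R x i)%:R - n%:R * st i) / n%:R.
  by field; rewrite gt_eqF.
by rewrite normrM [`|n%:R^-1|]ger0_norm// invr_ge0 (ltW n0).
Qed.

Let U01 i : 0 <= stickU i x <= 1. Proof. exact: stickU01. Qed.

Let aB ij : a ij <= 1.
Proof. by have := sum_partA_le U01 (fun i => stickS Gam i x) m_gt0 (s := [:: ij]) isT; rewrite big_seq1. Qed.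

Let c_ge0 ij : 0 <= c ij. Proof. by rewrite mulr_ge0 ?divr_ge0 ?partB_ge0. Qed.

Let cB ij : c ij <= 1.
Proof.
rewrite mulr_ile1 ?divr_ge0 ?partB_ge0 ?partB_le1// ler_pdivrMr// mul1r ler_nat.
rewrite (leq_trans (leq_subr _ _))//.
have : stick_pos ij.1 n%:R x <= n%:R.
  elim: ij.1 => [//|i IH]; apply: le_trans IH; exact: stick_pos_le (ltW n0).
by move/le_truncn; rewrite natrK.
Qed.

Let c_dist ij : `|c ij - a ij| <= n%:R^-1.
Proof.
rewrite /c /a /partA -mulrBl normrM [`|partB _ _ _|]ger0_norm ?partB_ge0//.
by rewrite (le_trans _ (L_st ij.1))// ler_piMr// partB_le1.
Qed.

Let M_ex : {M | stick_pos M n%:R x < 1 & stick_run Gam M n%:R x = t}.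
Proof. by have /cid[M [h1 h2]] := tx; exists M. Qed.

Let M := s2val M_ex.
Let r := [seq (i, j) | i <- iota 0 M, j <- iota 0 (size (cycle_lengths (stickS Gam i x)))].

Let tE : t = [seq (L i, stickS Gam i x) | i <- iota 0 M & (0 < L i)%N].
Proof. by rewrite -(s2valP' M_ex) stick_runE. Qed.

Let L_lt i : (0 < L i)%N -> (i < M)%N.
Proof.
have [//|Mi] := ltnP i M; rewrite /L /stick_pts.
suff -> : Num.truncn (stick_pos i n%:R x) = 0%N by rewrite sub0n.
apply: truncn_def; rewrite stick_pos_ge0 ?ltW//=.
rewrite (le_lt_trans _ (s2valP M_ex))// -/M -(subnK Mi).
elim: (i - M)%N => [//|k IH]; rewrite addSn; apply: le_trans IH.
exact: stick_pos_le (ltW n0).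
Qed.

Let ur : uniq r.
Proof.
apply: allpairs_uniq_dep; first exact: iota_uniq; first by move=> i _; exact: iota_uniq.
by move=> [i j] [i' j'] _ _ /= [-> ->].
Qed.

Let cr ij : 0 < c ij -> ij \in r.
Proof.
case: ij => i j h; apply/allpairsPdep; exists i, j; rewrite !mem_iota /= !add0n; split=> //.
  by apply: L_lt; rewrite lt0n; apply: contraTneq h => L0; rewrite /c/= L0 mul0r mul0r ltxx.
rewrite ltnNge; apply: contraTN h => sj.
by rewrite /c/= /partB /scaled_parts nth_default// mul0r mulr0 ltxx.
Qed.

Let values : seq nat :=
  flatten [seq [seq (L i * l)%N | l <- cycle_lengths (stickS Gam i x)] | i <- iota 0 M].

Let valuesE : [seq c ij | ij <- r] = [seq sc l | l <- values].
Proof.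
rewrite /r /values !map_flatten -!map_comp; congr flatten; apply/eq_map => i /=.
rewrite -[LHS]map_comp -[RHS]map_comp; apply: map_iota_nth => j /=.
rewrite /c /= /sc /partB /scaled_parts !natrM.
by field; rewrite !gt_eqF.
Qed.

Let values_perm : perm_eq [seq v <- cycle_lengths p | (0 < v)%N] [seq v <- values | (0 < v)%N].
Proof.
rewrite (perm_trans pt)// tE /blocks -map_comp /=.
rewrite /values (@filter_flatten_map _ _ (iota 0 M) (fun i => 0 < L i)%N)// => i.
rewrite -eqn0Ngt => /eqP ->; elim: (cycle_lengths _) => //=.
Qed.

Let filter_sc (s : seq nat) :
  [seq v <- [seq sc l | l <- s] | 0 < v] = [seq sc l | l <- [seq l <- s | (0 < l)%N]].
Proof.
rewrite filter_map; congr map; apply: eq_filter => l /=.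
by rewrite /sc pmulr_lgt0 ?ltr0n// invr_gt0 ltr0n muln_gt0 m_gt0.
Qed.

Let rearr_partC k : rearr (partC R p) k = rearr c k.
Proof.
apply: (@eq_rearr_perm _ _ _ _ _ (iota 0 (size (cycle_lengths p))) r).
- exact: iota_uniq.
- exact: ur.
- move=> i; rewrite mem_iota /= add0n; have [//|si] := ltnP i (size (cycle_lengths p)).
  by rewrite /partC /scaled_parts nth_default// mul0r ltxx.
- exact: cr.
rewrite valuesE filter_sc.
have -> : [seq partC R p i | i <- iota 0 (size (cycle_lengths p))] = [seq sc l | l <- cycle_lengths p].
  exact: map_iota_nth.
by rewrite filter_sc; apply: perm_map.
Qed.

Let sum_c : \sum_(ij <- r) c ij = 1.
Proof.
have sum_pos (s : seq nat) : (\sum_(l <- [seq l <- s | (0 < l)%N]) l = \sum_(l <- s) l)%N.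
  by rewrite big_filter big_mkcond /=; apply: eq_bigr => -[].
rewrite -(big_map c xpredT id) valuesE big_map /= -mulr_suml -natr_sum.
rewrite -sum_pos -(perm_big _ values_perm) sum_pos sumn_cycle_lengths card_prod !card_ord mulnC.
by rewrite mulfV// pnatr_eq0 -lt0n muln_gt0 m_gt0.
Qed.

Lemma rho_Linf_matching : (rho_Linf (rearr (partC R p)) (rearr a) <= (n%:R^-1)%:E)%E.
Proof.
apply: ge_ereal_sup => _ [k _ <-]; rewrite lee_fin rearr_partC.
by apply: (@rearr_lip R _ c a 1 n%:R^-1 k cB aB _ c_dist); rewrite invr_ge0 ltW.
Qed.

Lemma rho_L1_matching :
  (rho_L1 (rearr (partC R p)) (rearr a) <= ((2 / n%:R * (size t)%:R)%:E))%E.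
Proof.
apply: lime_le; first by apply: is_cvg_nneseries => k _ _; rewrite lee_fin.
near=> K; rewrite sumEFin lee_fin big_mkord.
under eq_bigr do rewrite rearr_partC.
rewrite (le_trans (rearr_L1 ur cr (partA_ge0 U01 _) c_ge0 (sum_partA_le U01 (fun i => stickS Gam i x) m_gt0) sum_c K))//.
rewrite -mulrA ler_pM2l// /r big_allpairs_dep /=.
have -> : (size t)%:R = \sum_(i <- iota 0 M) (0 < L i)%N%:R :> R.
  by rewrite tE size_map size_filter -sum1_count natr_sum big_mkcond/=; apply: eq_bigr => i _; case: ifP.
rewrite mulr_sumr; apply: ler_sum => i _.
have -> : \sum_(j <- iota 0 (size (cycle_lengths (stickS Gam i x)))) Num.max 0 (c (i, j) - a (i, j)) =
    Num.max 0 ((L i)%:R / n%:R - st i) *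
    \sum_(j < size (cycle_lengths (stickS Gam i x))) partB R (stickS Gam i x) j.
  rewrite -(big_mkord xpredT (partB R (stickS Gam i x))) /index_iota subn0 mulr_sumr.
  apply: eq_bigr => j _; rewrite /c /a /partA /= -mulrBl -{1}(mul0r (partB R (stickS Gam i x) j)).
  by rewrite -maxr_pMl ?partB_ge0.
rewrite (le_trans (ler_piMr _ (sum_partB_le _ _ m_gt0 _)))//; first by rewrite le_max lexx.
(* A stick without points has no excess of [c] over [a]; any other one has at most [1 / n]. *)
have [Li|] := posnP (L i).
  by rewrite Li mulr0 ge_max lexx mul0r sub0r oppr_le0 stick_ge0.
rewrite mulr1 ge_max invr_ge0 ltW//= (le_trans (ler_norm _) (L_st i))//.
Unshelve. all: by end_near.
Qed.

End Matching.

(** * The coupling *)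

Section MeasurableRearr.
Context d (T : measurableType d) (R : realType).

Lemma measurable_fun_fin_comp (X : finType) (F : T -> X) (g : X -> R) :
  (forall x, measurable [set w | F w = x]) -> measurable_fun setT (fun w => g (F w)).
Proof.
move=> mF _ Y _; rewrite setTI.
rewrite (_ : _ @^-1` Y = \bigcup_(x in [set x | Y (g x)]) [set w | F w = x]).
  by apply: fin_bigcup_measurable => [|x _]; [exact: finite_finset|exact: mF].
by apply/seteqP; split => [w /= Yw|w [x /= Yx Fx]]; [exists (F w)|rewrite /= Fx].
Qed.

(** The [k]-th largest entry exceeds [s >= 0] exactly when some [k + 1] distinct entries do, and
    there are countably many choices of these. *)
Lemma measurable_rearr (I : countType) (x : T -> I -> R) (B : R) k :
  (forall i, measurable_fun setT (x ^~ i)) -> (forall w i, x w i <= B) ->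
  measurable_fun setT (fun w => rearr (x w) k).
Proof.
move=> mx xB mT; apply: (measurability _ (@RGenOInfty.measurableE R)) => //.
move=> _ [_ [s ->] <-]; rewrite setTI.
have [s0|s0] := ltP s 0.
  rewrite (_ : _ @^-1` _ = setT)//; apply/seteqP; split => w //= _.
  by rewrite in_itv/= andbT (lt_le_trans s0)// (rearr_ge0 (xB w)).
pose E (f : {ffun 'I_k.+1 -> I}) : set T :=
  if injectiveb f then [set w | forall i, (i < k.+1)%N -> s < x w (f (inord i))] else set0.
rewrite (_ : _ @^-1` _ = \bigcup_f E f).
  apply: countable_bigcupT_measurable => [|f]; first exact: countableP.
  rewrite /E; case: ifP => // _.
  apply: (measurable_forall_lt (E := fun i => [set w | s < x w (f (inord i))])) => i.
  rewrite (_ : [set _ | _] = (x ^~ (f (inord i))) @^-1` `]s, +oo[).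
    by rewrite -[X in measurable X]setTI; exact: mx.
  by apply/seteqP; split=> w /=; rewrite in_itv/= andbT.
apply/seteqP; split => w /=; rewrite in_itv/= andbT.
  case/(rearr_gt s0) => f [fI fx]; exists (finfun f) => //; rewrite /E.
  have -> : injectiveb (finfun f) by apply/injectiveP => i j; rewrite !ffunE => /fI.
  by move=> i _; rewrite ffunE.
case=> f _; rewrite /E; case: ifP => // /injectiveP fI fx.
have fx' j : s < x w (f j) by have := fx j (ltn_ord j); rewrite inord_val.
(* The smallest of the chosen entries is a level above [s], which keeps the inequality strict. *)
have [j0 _ j0P] := @arg_minP _ _ _ (@ord0 k) xpredT (fun j => x w (f j)) isT.
by apply: lt_le_trans (fx' j0) _; apply: (rearr_ge (xB w) fI) => j; exact: j0P.
Qed.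

Lemma measurable_rho_Linf (a b : T -> nat -> R) :
  (forall k, measurable_fun setT (a ^~ k)) -> (forall k, measurable_fun setT (b ^~ k)) ->
  measurable_fun setT (fun w => rho_Linf (a w) (b w)).
Proof.
move=> ma mb.
rewrite (_ : (fun w => _) = (fun w => esups (fun k => (`|a w k - b w k|)%:E) 0)).
  apply: (@measurable_fun_esups _ _ _ setT (fun k w => (`|a w k - b w k|)%:E)) => k.
  by apply/measurable_EFinP/measurableT_comp => //; exact: measurable_funB.
apply/funext => w; rewrite /rho_Linf /esups /sdrop; congr ereal_sup.
by apply/seteqP; split => _ [k _ <-]; exists k.
Qed.

Lemma measurable_rho_L1 (a b : T -> nat -> R) :
  (forall k, measurable_fun setT (a ^~ k)) -> (forall k, measurable_fun setT (b ^~ k)) ->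
  measurable_fun setT (fun w => rho_L1 (a w) (b w)).
Proof.
move=> ma mb; apply: (@ge0_emeasurable_sum _ _ _ setT (fun k w => (`|a w k - b w k|)%:E) xpredT) => k.
  by move=> w _ _; rewrite lee_fin.
by move=> _; apply/measurable_EFinP/measurableT_comp => //; exact: measurable_funB.
Qed.

End MeasurableRearr.

Lemma pick_nth_mem (R : realType) (X : eqType) (x0 : X) (s : seq X) (v : R) :
  s != [::] -> pick_nth x0 s v \in s.
Proof.
by case: s => [//|y s] _; rewrite /pick_nth mem_nth// /pick_idx /= ltnS geq_minl.
Qed.

Section Coupling.
Variables (R : realType) (m n : nat) (Gam : {group {perm 'I_m}}).
Hypotheses (m_gt0 : (0 < m)%N) (n_gt0 : (0 < n)%N).
Notation rT := (measurableTypeR R).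
Notation P := (unif01 R).
Notation pt := ('I_n * 'I_m)%type.

(** Types of positive probability, so that each of them has a nonempty class of permutations. *)
Definition feller_types := [seq t <- undup (feller_supp Gam n 1) | feller_law Gam R n t != 0].

Lemma feller_mean_types psi : feller_mean Gam n 1 psi =
  \sum_(t <- feller_types) psi t * feller_law Gam R n t.
Proof.
rewrite feller_mean_law big_filter [RHS]big_mkcond /=; apply: eq_bigr => t _.
by case: eqP => //= ->; rewrite mulr0.
Qed.

Let ev t : set rT := stick_event Gam t n%:R.

Let mev t : measurable (ev t). Proof. exact: measurable_stick_event. Qed.

Let ev_law t : t \in feller_types -> P (ev t) = (feller_law Gam R n t)%:E.
Proof. by rewrite mem_filter => /andP[_]; exact: stick_event_law. Qed.

Let ev_inj t t' x : ev t x -> ev t' x -> t = t'.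
Proof. exact: stick_event_inj. Qed.

Let types_uniq : uniq feller_types. Proof. by rewrite filter_uniq// undup_uniq. Qed.

(** The value is the default [[::]] when no event occurs. *)
Definition type_of (x : R) : seq (nat * {perm 'I_m}) :=
  nth [::] feller_types (seq.find (fun t => `[< ev t x >]) feller_types).

Let type_ofE t x : t \in feller_types -> ev t x -> type_of x = t.
Proof.
move=> tT evt; have h : has (fun t => `[< ev t x >]) feller_types.
  by apply/hasP; exists t => //; apply/asboolP.
by have /asboolP := nth_find [::] h => evt'; exact: ev_inj evt' evt.
Qed.

Let type_of_none x : (forall t, t \in feller_types -> ~ ev t x) -> type_of x = [::].
Proof.
move=> H; rewrite /type_of hasNfind ?nth_default//.
by apply/hasPn => t tT; apply/asboolP; exact: H.
Qed.

Let type_of_mem x : type_of x \in [::] :: feller_types.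
Proof.
rewrite inE /type_of; case: (ltnP (seq.find (fun t => `[< ev t x >]) feller_types) (size feller_types)) => h.
  by rewrite mem_nth ?orbT.
by rewrite nth_default.
Qed.

Let covered : set rT := \big[setU/set0]_(t <- feller_types) ev t.

Let mcovered : measurable covered. Proof. exact: bigsetU_measurable. Qed.

Let measurable_type_of t : measurable ([set x | type_of x = t] : set rT).
Proof.
rewrite (_ : [set _ | _] = (if t \in feller_types then ev t else set0) `|`
    (if t == [::] then ~` covered else set0)).
  by apply: measurableU; case: ifP => // _; apply: measurableC.
apply/seteqP; split => x /=.
  have [[t' t'T et']|nt] := pselect (exists2 t', t' \in feller_types & ev t' x).
    by rewrite (type_ofE t'T et') => <-; left; rewrite t'T.
  rewrite type_of_none => [<-|t' t'T et']; last by apply: nt; exists t'.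
  by right; rewrite eqxx => /bigsetU_seqP[t' ? ?]; apply: nt; exists t'.
case; first by case: ifP => // tT; exact: type_ofE.
case: eqP => // -> ncov; apply: type_of_none => t' t'T et'; apply: ncov.
by apply/bigsetU_seqP; exists t'.
Qed.

Definition perm_class (s : seq nat) : seq {perm pt} :=
  [seq p <- enum (wreath n Gam) |
    perm_eq [seq v <- cycle_lengths p | (0 < v)%N] [seq v <- s | (0 < v)%N]].

Let size_perm_class s : (size (perm_class s))%:R = \sum_(p in wreath n Gam)
  (perm_eq [seq v <- cycle_lengths p | (0 < v)%N] [seq v <- s | (0 < v)%N])%:R :> R.
Proof.
rewrite size_filter -sum1_count natr_sum big_mkcond /= big_enum /=.
by apply: eq_bigr => p _; case: ifP.
Qed.

(** [mean_wreath_feller] for the indicator of the cycle lengths [s]: the relative size of the class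
    is the probability that the blocks produce [s]. *)
Let size_perm_class_types s : (size (perm_class s))%:R = #|wreath n Gam|%:R *
  \sum_(t <- feller_types) (perm_eq [seq v <- blocks t | (0 < v)%N]
     [seq v <- s | (0 < v)%N])%:R * feller_law Gam R n t.
Proof.
rewrite size_perm_class.
pose phi (s' : seq nat) : R := (perm_eq [seq v <- s' | (0 < v)%N] [seq v <- s | (0 < v)%N])%:R.
rewrite (@mean_wreath_feller m n Gam R phi)//; last first.
  by move=> s1 s2 s12; rewrite /phi (permPl s12).
by rewrite -(feller_mean_law _ _ (phi \o @blocks m)) feller_mean_types.
Qed.

Let perm_class_neq0 t : t \in feller_types -> perm_class (blocks t) != [::].
Proof.
move=> tT; rewrite -size_eq0 -lt0n -(ltr0n R) size_perm_class_types.
have W0 : 0 < #|wreath n Gam|%:R :> R.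
  by rewrite ltr0n (cardG_gt0 (wreath_gp n Gam)).
rewrite mulr_gt0// (bigD1_seq t)//= perm_refl mul1r ltr_pwDl//.
  by move: tT; rewrite mem_filter lt_neqAle eq_sym => /andP[-> _]; exact: feller_law_ge0.
by apply: sumr_ge0 => t' _; rewrite mulr_ge0 ?ler0n ?feller_law_ge0.
Qed.

(** The even digits drive the sticks, hence the type; the odd digits, independent of them, choose
    within the class. *)
Definition coupled_perm (w : R) : {perm pt} :=
  pick_nth 1%g (perm_class (blocks (type_of (even_bits w)))) (odd_bits w).

Let mclass s p : measurable ([set v | pick_nth 1%g (perm_class s) v = p] : set rT).
Proof. exact: (measurable_pick_nth 1%g (perm_class s) (eq^~ p)). Qed.

Lemma measurable_coupled_perm p : measurable ([set w | coupled_perm w = p] : set rT).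
Proof.
rewrite (_ : [set _ | _] = \big[setU/set0]_(t <- [::] :: feller_types)
    (@odd_bits R @^-1` [set v | pick_nth 1%g (perm_class (blocks t)) v = p] `&`
     @even_bits R @^-1` [set x | type_of x = t])).
  apply: bigsetU_measurable => t _; apply: measurableI.
    by apply: measurable_pre_odd_bits; exact: mclass.
  by apply: measurable_pre_even_bits; exact: measurable_type_of.
apply/seteqP; split => w /=; last first.
  by move=> /bigsetU_seqP[t _ [/= h1 h2]]; rewrite /coupled_perm h2.
by move=> h; apply/bigsetU_seqP; exists (type_of (even_bits w)).
Qed.

(** Given a type compatible with [p], the permutation [p] is chosen with probability 1 over the size
    of its class; the compatible types have total mass the relative size of that class, and the size
    cancels. *)
Let coupled_perm_ge p : p \in wreath n Gam ->
  ((#|wreath n Gam|%:R^-1)%:E <= P [set w | coupled_perm w = p])%E.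
Proof.
move=> pW; pose s := cycle_lengths p.
have N0 : 0 < (size (perm_class s))%:R :> R.
  have : p \in perm_class s by rewrite mem_filter perm_refl mem_enum.
  by rewrite ltr0n; case: (perm_class s).
pose F t : set rT := @odd_bits R @^-1` [set v | pick_nth 1%g (perm_class (blocks t)) v = p] `&`
  @even_bits R @^-1` (ev t).
have mF t : measurable (F t).
  by apply: measurableI; [apply: measurable_pre_odd_bits; exact: mclass|exact: measurable_pre_even_bits].
apply: (@le_trans _ _ (P (\big[setU/set0]_(t <- feller_types) F t))); last first.
  apply: le_measure; rewrite ?inE; first exact: bigsetU_measurable.
    exact: measurable_coupled_perm.
  move=> w /bigsetU_seqP[t tT [/= h1 h2]].
  by rewrite /coupled_perm (type_ofE tT h2).
rewrite measure_bigsetU_seq//; last first.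
  by move=> t t' w _ _ [_ /= h] [_ /= h']; exact: ev_inj h h'.
have -> : #|wreath n Gam|%:R^-1 = \sum_(t <- feller_types)
    (size (perm_class s))%:R^-1 * ((perm_eq [seq v <- blocks t | (0 < v)%N]
     [seq v <- s | (0 < v)%N])%:R * feller_law Gam R n t).
  rewrite -mulr_sumr; have := size_perm_class_types s.
  move: (\sum_(t <- feller_types) _) => X E; rewrite E in N0 *.
  have := N0; rewrite pmulr_rgt0 ?ltr0n ?(cardG_gt0 (wreath_gp n Gam))// => X0.
  by rewrite invfM -mulrA mulVf ?mulr1// gt_eqF.
rewrite -sumEFin big_seq [leRHS]big_seq; apply: lee_sum => t tT.
have Ft : P (F t) = (P [set v | pick_nth 1%g (perm_class (blocks t)) v = p] * P (ev t))%E.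
  by apply: unif01_bits_rect; first exact: mclass.
have := lexx (P (F t)); rewrite {1}Ft; apply: le_trans.
rewrite ev_law//; case: (boolP (perm_eq _ _)) => pe; last first.
  by rewrite mul0r mulr0 mule_ge0// lee_fin feller_law_ge0.
have cE : perm_class (blocks t) = perm_class s.
  by apply: eq_filter => q; rewrite (permPr pe).
rewrite cE unif01_pick_nth ?mul1r//; first by rewrite filter_uniq// enum_uniq.
by rewrite mem_filter perm_refl mem_enum.
Qed.

Lemma uniform_coupled_perm : uniform_on P coupled_perm (wreath n Gam).
Proof.
split=> [g|g gW]; first exact: measurable_coupled_perm.
have W0 : #|wreath n Gam|%:R != 0 :> R.
  by rewrite pnatr_eq0 -lt0n (cardG_gt0 (wreath_gp n Gam)).
apply: (@probability_eq_of_ge _ (enum (wreath n Gam)) _ rT R P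
  (fun p => [set w | coupled_perm w = p]) (fun=> #|wreath n Gam|%:R^-1)).
- exact: enum_uniq.
- by move=> p _; exact: measurable_coupled_perm.
- by move=> p q w _ _ /= -> .
- by rewrite big_const_seq count_predT -cardE iter_addr addr0 -[LHS]mulr_natl mulfV.
- by move=> p; rewrite mem_enum; exact: coupled_perm_ge.
- by rewrite mem_enum.
Qed.

Definition coupledU (i : nat) (w : R) : R := stickU i (even_bits w).
Definition coupledS (i : nat) (w : R) : {perm 'I_m} := stickS Gam i (even_bits w).

Lemma stick_ingredients_coupled : stick_ingredients P Gam coupledU coupledS.
Proof.
have [mU [mS H]] := @stick_ingredients_unif01 R m Gam.
split; first by move=> i; exact: (measurableT_comp (mU i) (measurable_even_bits (R := R))).
split; first by move=> i g; exact: (measurable_pre_even_bits (mS i g)).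
move=> N t g tg; rewrite -(H N t g tg).
apply: (preimage_even_bits (B := [set w | forall i, (i < N)%N -> stickU i w <= t i /\ stickS Gam i w = g i])).
apply: (measurable_forall_lt (E := fun i => [set w | stickU i w <= t i /\ stickS Gam i w = g i])) => i.
apply: (measurableI [set w | stickU i w <= t i] [set w | stickS Gam i w = g i]); last exact: mS.
by rewrite -[X in measurable X]setTI; apply: measurable_fun_le => //; exact: mU.
Qed.

Let A w := partA (fun i => coupledU i w) (fun i => coupledS i w).

Let measurable_rearr_A k : measurable_fun setT (fun w : rT => rearr (A w) k).
Proof.
have [mU [mS _]] := stick_ingredients_coupled.
apply: (@measurable_rearr _ rT R (nat * nat)%type A 1) => [[i j]|w ij]; last first.
  have := sum_partA_le (fun i => stickU01 i (even_bits w)) (fun i => coupledS i w) m_gt0 (s := [:: ij]) isT.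
  by rewrite big_seq1.
apply: measurable_funM.
  apply: measurable_funM; first exact: mU.
  by apply: measurable_prod => r _; apply: measurable_funB => //; exact: mU.
exact: (@measurable_fun_fin_comp _ rT R _ (coupledS i) (fun s => partB R s j) (mS i)).
Qed.

Let measurable_rearr_C k : measurable_fun setT (fun w : rT => rearr (partC R (coupled_perm w)) k).
Proof.
exact: (@measurable_fun_fin_comp _ rT R _ coupled_perm (fun p => rearr (partC R p) k)
  measurable_coupled_perm).
Qed.

(** On the event of type [t] the distance is at most [f t], and these events cover almost
    everything, so the expectation is at most the mean of [f] over the types. *)
Lemma dist_CA_le (rho : (nat -> R) -> (nat -> R) -> \bar R) (f : seq (nat * {perm 'I_m}) -> R) :
  measurable_fun setT (fun w : rT => rho (rearr (partC R (coupled_perm w))) (rearr (A w))) ->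
  (forall a b, 0 <= rho a b)%E -> (forall t, 0 <= f t) ->
  (forall x t (p : {perm pt}), stick_event Gam t n%:R x ->
     perm_eq [seq v <- cycle_lengths p | (0 < v)%N] [seq v <- blocks t | (0 < v)%N] ->
     (rho (rearr (partC R p)) (rearr (partA (fun i => stickU i x) (fun i => stickS Gam i x))) <= (f t)%:E)%E) ->
  (dist_CA rho n Gam <= (feller_mean Gam n 1 f)%:E)%E.
Proof.
move=> mrho rho0 f0 H; apply: ge_ereal_inf.
exists (\int[P]_w rho (rearr (partC R (coupled_perm w))) (rearr (A w)))%E.
  exists _, rT, P, coupled_perm, coupledU, coupledS; split => //.
    exact: uniform_coupled_perm.
  exact: stick_ingredients_coupled.
pose E t : set rT := @even_bits R @^-1` (ev t).
have mE t : measurable (E t) by exact: measurable_pre_even_bits.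
have mI t : measurable_fun setT (fun w : rT => (f t)%:E * (\1_(E t) w)%:E)%E.
  by apply: emeasurable_funM => //; apply/measurable_EFinP/measurable_indic.
have I0 t w : (0 <= (f t)%:E * (\1_(E t) w)%:E)%E by rewrite mule_ge0// lee_fin.
apply: (@le_trans _ _ (\int[P]_w (\sum_(t <- feller_types) (f t)%:E * (\1_(E t) w)%:E))%E).
  apply: ae_ge0_le_integral => //.
  - by move=> w _; apply: sume_ge0.
  - exact: emeasurable_sum.
  (* Outside all the events nothing bounds the distance; this set is null because the probabilities
     of the types add up to 1. *)
  exists (@even_bits R @^-1` (~` covered)); split.
  - by apply: measurable_pre_even_bits; apply: measurableC.
  - transitivity (P (~` covered)); first exact: (preimage_even_bits (measurableC mcovered)).
    rewrite probability_setC// measure_bigsetU_seq//; last first.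
      by move=> t t' x _ _; exact: ev_inj.
    rewrite (eq_big_seq (fun t => (feller_law Gam R n t)%:E)) => [|t]; last exact: ev_law.
    rewrite sumEFin (_ : \sum_(t <- _) _ = 1) ?subee//.
    by rewrite -[RHS](feller_mean_cst Gam n 1 1) feller_mean_types; apply: eq_bigr => t _; rewrite mul1r.
  - move=> w /= bad cov; apply: bad => _.
    have /bigsetU_seqP[t tT et] := cov.
    rewrite (bigD1_seq t)//= indicE mem_set// mule1.
    apply: (@le_trans _ _ (f t)%:E); last by rewrite leeDl// sume_ge0.
    apply: H => //; have := pick_nth_mem 1%g (odd_bits w) (perm_class_neq0 tT).
    by rewrite /coupled_perm (type_ofE tT et) mem_filter => /andP[].
rewrite ge0_integral_sum// feller_mean_types -sumEFin big_seq [leRHS]big_seq.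
apply: lee_sum => t tT; rewrite ge0_integralZl//; last first.
- by rewrite lee_fin.
- by apply/measurable_EFinP/measurable_indic.
have Et : P (E t) = (feller_law Gam R n t)%:E.
  by rewrite -ev_law//; exact: (preimage_even_bits (mev t)).
have := lexx ((f t)%:E * P (E t))%E; rewrite {2}Et integral_indic// setIT.
by apply: le_trans.
Qed.

Lemma dist_CA_Linf : (dist_CA (@rho_Linf R) n Gam <= (n%:R^-1)%:E)%E.
Proof.
rewrite -(feller_mean_cst Gam n 1 n%:R^-1); apply: dist_CA_le => //.
- by apply: measurable_rho_Linf => k; [exact: measurable_rearr_C|exact: measurable_rearr_A].
- move=> a b; apply: (@le_trans _ _ (`|a 0%N - b 0%N|)%:E); first by rewrite lee_fin.
  by apply: ereal_sup_ubound; exists 0%N.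
- by move=> x t p tx pt'; exact: (rho_Linf_matching m_gt0 n_gt0 tx pt').
Qed.

Lemma dist_CA_L1 : (dist_CA (@rho_L1 R) n Gam <=
  (2 / n%:R * \sum_(1 <= j < n.+1) j%:R^-1)%:E)%E.
Proof.
rewrite -(feller_mean_size Gam R n 1) -feller_meanZ; apply: dist_CA_le => //.
- by apply: measurable_rho_L1 => k; [exact: measurable_rearr_C|exact: measurable_rearr_A].
- by move=> a b; apply: nneseries_ge0 => k _ _; rewrite lee_fin.
- by move=> x t p tx pt'; exact: (rho_L1_matching m_gt0 n_gt0 tx pt').
Qed.

End Coupling.

(** * Harmonic numbers and the logarithm *)

Section Harmonic.
Variable R : realType.

(** Both bounds are [ln (1 + x) <= x], for [x = -1 / (k + 1)] and [x = 1 / k]. *)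
Lemma ln_step (k : nat) : (0 < k)%N ->
  (k.+1%:R : R)^-1 <= ln k.+1%:R - ln k%:R <= (k%:R : R)^-1.
Proof.
move=> k0; have k0' : 0 < k%:R :> R by rewrite ltr0n.
have k1 : 0 < k.+1%:R :> R by rewrite ltr0n.
apply/andP; split.
  rewrite -lerN2 opprB -ln_div ?posrE//.
  have -> : k%:R / k.+1%:R = 1 + - (k.+1%:R)^-1 :> R.
    by rewrite -natr1; field; rewrite natr1 gt_eqF.
  by apply: le_ln1Dx; rewrite ltrN2 invf_lt1// ltr1n.
rewrite -ln_div ?posrE//.
have -> : k.+1%:R / k%:R = 1 + (k%:R)^-1 :> R by rewrite -natr1; field; rewrite gt_eqF.
by apply: le_ln1Dx; rewrite (lt_trans _ (_ : 0 < _)) ?invr_gt0// oppr_lt0.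
Qed.

Lemma ln_harmonic (n : nat) : (0 < n)%N ->
  ln n%:R <= \sum_(1 <= j < n.+1) (j%:R : R)^-1 <= 1 + ln n%:R.
Proof.
case: n => [//|n] _; set H := fun k => \sum_(1 <= j < k.+1) (j%:R : R)^-1.
have HS k : H k.+1 = H k + (k.+1%:R)^-1 by rewrite /H big_nat_recr.
have H1 : H 1%N = 1 by rewrite /H big_nat1 invr1.
rewrite -/(H n.+1); apply/andP; split.
  (* The induction is run on the stronger bound [ln (k + 1) <= H_k], which is what the telescoped
     steps give. *)
  have h : ln n.+2%:R <= H n.+1.
    elim: n => [|n IH]; last first.
      have /andP[_ h2] := @ln_step n.+2 isT; rewrite HS.
      by rewrite -(subrK (ln n.+2%:R) (ln _)) addrC lerD.
    by rewrite H1; have /andP[_] := @ln_step 1 isT; rewrite ln1 invr1 subr0.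
  by apply: le_trans h; rewrite ler_ln ?posrE// ler_nat.
elim: n => [|n IH]; first by rewrite H1 ln1 addr0.
have /andP[h1 _] := @ln_step n.+1 isT; rewrite HS.
by rewrite -(subrK (ln n.+1%:R) (ln n.+2%:R)) [_ - _ + _]addrC addrA lerD.
Qed.

Lemma euler_gamma_ge0 : 0 <= euler_gamma R.
Proof.
rewrite /euler_gamma; set u := fun n : nat => _.
(* For a divergent sequence [limn] takes the default value 0. *)
have [cu|ncu] := pselect (cvgn u); last by rewrite dvgP.
apply: limr_ge => //; near=> n; rewrite subr_ge0.
have n0 : (0 < n)%N by near: n; exists 1%N.
by have /andP[] := ln_harmonic n0.
Unshelve. all: by end_near.
Qed.

End Harmonic.

Theorem mainTheorem6 (R : realType) (m : nat) (Gam : {group {perm 'I_m}}) :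
  (1 <= m)%N ->
  (forall n : nat, (1 <= n)%N ->
     (dist_CA (@rho_Linf R) n Gam <= (n%:R^-1)%:E)%E) /\
  (exists K : R, forall n : nat, (1 <= n)%N ->
     (dist_CA (@rho_L1 R) n Gam
        <= (3 * (ln n%:R + euler_gamma R) / n%:R + K / (n%:R ^+ 2))%:E)%E).
Proof.
move=> m0; split=> [n n0|]; first exact: dist_CA_Linf.
(* The coupling gives [2 H_n / n <= (2 + 2 ln n) / n]. If [ln n >= 2], this is at most [3 ln n / n];
   otherwise [n < e^2], and the excess [2 / n] is at most [2 e^2 / n^2]. *)
exists (2 * expR 2) => n n0; apply: le_trans (dist_CA_L1 R Gam m0 n0) _; rewrite lee_fin.
have n0' : 0 < n%:R :> R by rewrite ltr0n.
have /andP[_ hH] := @ln_harmonic R n n0; have g0 := euler_gamma_ge0 R.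
have l0 : 0 <= ln n%:R :> R by rewrite ln_ge0// ler1n.
rewrite -(ler_pM2r n0') (_ : 2 / _ * _ * _ = 2 * \sum_(1 <= j < n.+1) j%:R^-1); last first.
  by field; rewrite gt_eqF.
have -> : (3 * (ln n%:R + euler_gamma R) / n%:R + 2 * expR 2 / n%:R ^+ 2) * n%:R =
    3 * (ln n%:R + euler_gamma R) + 2 * (expR 2 / n%:R).
  by field; rewrite gt_eqF.
have e0 : 0 <= expR 2 / n%:R :> R by rewrite divr_ge0 ?expR_ge0.
have [l2|l2] := leP 2 (ln n%:R : R); first by lra.
have : 1 <= expR 2 / n%:R :> R.
  by rewrite ler_pdivlMr// mul1r -(@lnK R n%:R) ?posrE// ler_expR ltW.
lra.
Qed.
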